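(* Let $A$ be a real $m\times n$ matrix with full column rank ($m\ge n$), let $b\in\mathbb{R}^m$, let $x_*\in\mathbb{R}^n$ be a solution of the system $Ax=b$, and let $s\ge 1$ be an integer. For any initial estimate $x_0\in\mathbb{R}^n$, the block Gaussian Kaczmarz method with block size $s$ produces a sequence of iterates $\{x_k,\ k\ge 0\}$ that satisfies, for every $k\ge 0$, $$\mathbb{E}\|x_k-x_*\|_2^2\le\left(1-\frac{1}{80}\left[\frac{\sqrt{s}\,\sigma_{\min}(A)}{\sqrt{s}\,\|A\|+\|A\|_F}\right]^2\right)^k\|x_0-x_*\|_2^2 .$$
   Context: $\sigma_{\min}(A)$ denotes the smallest singular value of $A$ (smallest eigenvalue of $\sqrt{A^TA}$), $\|A\|=\sup_{\|x\|_2=1}\|Ax\|_2$ is the operator norm, $\|A\|_F=\sqrt{\mathrm{trace}(A^TA)}$ is the Frobenius norm. $M^\dagger$ denotes the Moore-Penrose inverse of a matrix $M$. Block Gaussian Kaczmarz (BGK) method with block size $s$: starting from a deterministic $x_0\in\mathbb{R}^n$, at each iteration a new $m\times s$ random matrix $S$ with i.i.d. standard normal entries is drawn, independently of all matrices drawn at previous iterations, and $$x_{k+1}=\bigl(\mathrm{Id}-(S^TA)^\dagger S^TA\bigr)x_k+(S^TA)^\dagger S^Tb .$$ The expectation $\mathbb{E}$ is over all the random matrices drawn. *)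

(* Defs.v *)
From mathcomp Require Import all_boot all_order all_algebra.
From mathcomp Require Import all_classical all_reals all_analysis.

Set Implicit Arguments.
Unset Strict Implicit.
Unset Printing Implicit Defensive.

Import Order.TTheory GRing.Theory Num.Theory.
Import numFieldNormedType.Exports.

Local Open Scope classical_set_scope.
Local Open Scope ring_scope.

Section MatrixNotions.
Variable R : realType.

(* MathComp-Analysis's norm `|x| on matrices is the max norm, hence this
   separate definition of the Euclidean norm. *)
Definition norm2 n (x : 'cV[R]_n) : R := Num.sqrt (\sum_(i < n) x i 0 ^+ 2).

Definition opnorm m n (A : 'M[R]_(m, n)) : R :=
  sup [set norm2 (A *m x) | x in [set x : 'cV[R]_n | norm2 x = 1]].

Definition frobnorm m n (A : 'M[R]_(m, n)) : R := Num.sqrt (\tr (A^T *m A)).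

Definition psd n (B : 'M[R]_n) : Prop :=
  B^T = B /\ forall x : 'cV[R]_n, 0 <= (x^T *m B *m x) 0 0.

(* Every positive semidefinite M has exactly one positive semidefinite square
   root, so the default value 0 is not used for such M. *)
Definition psd_sqrt n (M : 'M[R]_n) : 'M[R]_n :=
  xget 0 [set B | psd B /\ B *m B = M].

(* The set of eigenvalues is finite, and nonempty when 0 < n, so that the
   infimum is a minimum. *)
Definition sigma_min m n (A : 'M[R]_(m, n)) : R :=
  inf [set a : R | eigenvalue (psd_sqrt (A^T *m A)) a].

Definition penrose m n (M : 'M[R]_(m, n)) (X : 'M[R]_(n, m)) : Prop :=
  [/\ M *m X *m M = M,
      X *m M *m X = X,
      (M *m X)^T = M *m X
    & (X *m M)^T = X *m M].

(* Exactly one X satisfies the four Penrose equations, so the default value 0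
   is not used.  MathComp's pinvmx is only a one-sided generalized inverse. *)
Definition moore_penrose m n (M : 'M[R]_(m, n)) : 'M[R]_(n, m) :=
  xget 0 [set X | penrose M X].

End MatrixNotions.

Section Independence.
Context d (T : measurableType d) (R : realType) (P : probability T R).

Definition mutually_independent (I : eqType) (X : I -> {RV P >-> R}) : Prop :=
  forall (J : seq I) (B : I -> set R), uniq J ->
    (forall i, measurable (B i)) ->
    P (\bigcap_(i in [set` J]) (X i @^-1` B i)) =
      (\prod_(i <- J) P (X i @^-1` B i))%E.

Definition sigma_generated (I : Type) (X : I -> {RV P >-> R}) (D : set I) :
    set (set T) :=
  <<s \bigcup_(i in D) preimage_set_system setT (X i) measurable >>.

Definition independent_systems (F G : set (set T)) : Prop :=
  forall E1 E2, F E1 -> G E2 -> P (E1 `&` E2) = (P E1 * P E2)%E.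

End Independence.

Section BlockGaussianKaczmarz.
Context d (T : measurableType d) (R : realType) (P : probability T R).
Variables (m s : nat).

(* S k (i, j) is the (i, j) entry of the m x s matrix drawn at iteration k. *)
Definition gaussian_draws (S : nat -> 'I_m * 'I_s -> {RV P >-> R}) : Prop :=
  [/\ forall k ij (B : set R), measurable B ->
        distribution P (S k ij) B = normal_prob 0 1 B,
      forall k, mutually_independent (S k)
    & forall k, independent_systems P
        (sigma_generated (S k) setT)
        (sigma_generated (fun p : nat * ('I_m * 'I_s) => S p.1 p.2)
           [set p | (p.1 < k)%N])].

Definition draw (S : nat -> 'I_m * 'I_s -> {RV P >-> R}) (k : nat) (w : T) :
    'M[R]_(m, s) :=
  \matrix_(i < m, j < s) S k (i, j) w.

End BlockGaussianKaczmarz.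

Definition bgk_step (R : realType) m n s (A : 'M[R]_(m, n)) (b : 'cV[R]_m)
    (S : 'M[R]_(m, s)) (x : 'cV[R]_n) : 'cV[R]_n :=
  (1%:M - moore_penrose (S^T *m A) *m (S^T *m A)) *m x
  + moore_penrose (S^T *m A) *m S^T *m b.

Fixpoint bgk (R : realType) m n s (A : 'M[R]_(m, n)) (b : 'cV[R]_m)
    (x0 : 'cV[R]_n) (S : nat -> 'M[R]_(m, s)) (k : nat) : 'cV[R]_n :=
  if k is k'.+1 then bgk_step A b (S k') (bgk A b x0 S k') else x0.

(* Main.v *)
Require Import Defs.
From HB Require Import structures.
From mathcomp Require Import all_boot all_order all_algebra.
From mathcomp Require Import all_classical all_reals all_analysis.
From mathcomp Require Import measurable_realfun measurable_fun_approximation.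
From mathcomp Require Import ring lra.

Set Implicit Arguments.
Unset Strict Implicit.
Unset Printing Implicit Defensive.

Import Order.TTheory GRing.Theory Num.Theory.
Import numFieldNormedType.Exports.

Local Open Scope classical_set_scope.
Local Open Scope ring_scope.

(** Write Pi for the orthogonal projection of R^n onto the row space of
    S^T A.  Since A xstar = b, one iteration maps the error e = x - xstar to
    (1 - Pi) e, which is the shortest vector of the form e - (S^T A)^T y.
    Hence it is at most as long as the error left by any gradient step
       e - t A^T S S^T A e,
    whose squared length is a quartic polynomial in the entries of S
    ([rowproj_best]).

    With a = A e, the second and fourth moments of S, computed by Wick's
    formula ([has_mean4]), give
       E |S^T a|^2          = s |a|^2,
       E |A^T S S^T a|^2    = s ((s + 1) |A^T a|^2 + |A|_F^2 |a|^2)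
    ([has_mean_sketch_sqr], [has_mean_sketch_fourth]).  The second right-hand
    side is at most s D |a|^2 with D = (s + 1) |A|^2 + |A|_F^2, so that the step
    t = 1 / D leaves a mean squared error of at most |e|^2 - s |a|^2 / D.
    As |A| <= |A|_F, D is at most 2 (sqrt s |A| + |A|_F)^2; together with
    |a| >= sigma_min |e| this yields the claimed contraction, with 1/2 where the
    theorem has 1/80 ([contraction_le_stepsize]).

    This bound holds for a fixed e.  In the iteration e is random, but it is a
    function of the earlier draws only.  Independence then identifies the joint
    law of the current draw and the past with a product measure, and Tonelli's
    theorem allows to integrate over the current draw first, with e frozen
    ([indep_systems_tonelli]).  To apply it, one has to know that the error is
    measurable for the sigma-algebra of the past.  The projection Pi is not
    continuous in S, but 1 - Pi is the limit of the resolvents (1 + k M^T M)^-1,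
    M = S^T A, whose entries are rational functions of those of M
    ([cvg_gram_resolvent], [measurable_bgk_error]). *)

(** * Integration against independent sigma-algebras *)

Section IndependentRandomElements.
Context (d d1 d2 : measure_display) (T : measurableType d) (R : realType).
Context (P : probability T R).
Context (T1 : measurableType d1) (T2 : measurableType d2).
Variables (U : {RV P >-> T1}) (V : {RV P >-> T2}).
Hypothesis indepUV : forall A B, measurable A -> measurable B ->
  P (U @^-1` A `&` V @^-1` B) = (P (U @^-1` A) * P (V @^-1` B))%E.

Let joint (w : T) : T1 * T2 := (U w, V w).
Let measurable_joint : measurable_fun setT joint.
Proof. exact: measurable_fun_pair. Qed.
HB.instance Definition _ :=
  isMeasurableFun.Build _ _ _ _ joint measurable_joint.

Let P1 : probability T1 R := distribution P U.
Let P2 : probability T2 R := distribution P V.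

Let joint_distribution (X : set (T1 * T2)) : measurable X ->
  distribution P joint X = (P1 \x P2)%E X.
Proof.
move=> mX; apply/esym; apply: product_measure_unique mX => A B mA mB.
by rewrite /P1 /P2 /distribution /pushforward/= -indepUV.
Qed.

(** The joint law of [U] and [V] agrees with the product of their laws on
    measurable rectangles, hence everywhere. *)
Lemma indep_tonelli (f : T1 * T2 -> \bar R) :
  measurable_fun setT f -> (forall z, 0 <= f z)%E ->
  (\int[P]_w f (U w, V w) = \int[P]_v \int[P]_u f (U u, V v))%E.
Proof.
move=> mf f0.
transitivity (\int[distribution P joint]_z f z)%E.
  by rewrite ge0_integral_distribution.
transitivity (\int[P1 \x P2]_z f z)%E.
  by apply: eq_measure_integral => A mA _; exact: joint_distribution.
rewrite fubini_tonelli2// ge0_integral_distribution//.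
- apply: eq_integral => v _.
  rewrite /= /fubini_G ge0_integral_distribution//.
  exact: measurableT_comp.
- exact: measurable_fun_fubini_tonelli_G.
- by move=> y; exact: integral_ge0.
Qed.

(** Measurability of the inner integral of [indep_tonelli], which monotonicity
    of the outer integral asks for. *)
Lemma measurable_partial_integral (f : T1 * T2 -> \bar R) :
  measurable_fun setT f -> (forall z, 0 <= f z)%E ->
  measurable_fun setT (fun v => \int[P]_u f (U u, V v))%E.
Proof.
move=> mf f0.
have mF := measurable_fun_fubini_tonelli_G (m1 := P1) f mf f0.
apply: eq_measurable_fun (measurableT_comp mF (measurable_funP V)) => v _.
by rewrite /= /fubini_G ge0_integral_distribution//; exact: measurableT_comp.
Qed.

Lemma indep_expectationM (X : T1 -> R) (Y : T2 -> R) :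
  measurable_fun setT X -> measurable_fun setT Y ->
  P.-integrable setT (EFin \o (X \o U)) ->
  P.-integrable setT (EFin \o (Y \o V)) ->
  (\int[P]_w (X (U w) * Y (V w))%:E =
   \int[P]_w (X (U w))%:E * \int[P]_w (Y (V w))%:E)%E.
Proof.
move=> mX mY iX iY.
pose f (z : T1 * T2) := (X z.1 * Y z.2)%:E.
have mf : measurable_fun setT f.
  by apply/measurable_EFinP; apply: measurable_funM; exact: measurableT_comp.
have mXU : measurable_fun setT (X \o U) by exact: measurableT_comp.
have mYV : measurable_fun setT (Y \o V) by exact: measurableT_comp.
have iXY : P.-integrable setT (f \o joint).
  apply/integrableP; split; first exact: measurableT_comp.
  have -> : (\int[P]_w `|(f \o joint) w| =
      \int[P]_v \int[P]_u (`|X (U u)|%:E * `|Y (V v)|%:E))%E.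
    rewrite -(indep_tonelli (f := fun z => `|X z.1|%:E * `|Y z.2|%:E)%E)//.
      by apply: eq_integral => w _; rewrite /= normrM EFinM.
    by apply: emeasurable_funM; apply/measurable_EFinP;
      do 2! apply: measurableT_comp => //.
  under eq_integral => v _.
    rewrite ge0_integralZr//; last first.
      by apply/measurable_EFinP; exact: measurableT_comp.
    over.
  rewrite ge0_integralZl//; last 2 first.
  - by apply/measurable_EFinP; exact: measurableT_comp.
  - exact: integral_ge0.
  apply: lte_mul_pinfty; first exact: integral_ge0.
    by have /(integral_fune_fin_num measurableT) := integrable_abse iX.
  by case/integrableP : iY.
have joint_int (g : T1 * T2 -> \bar R) :
    (\int[distribution P joint]_z g z)%E = (\int[P1 \x P2]_z g z)%E.
  by apply: eq_measure_integral => A mA _; exact: joint_distribution.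
have iprod : (P1 \x P2)%E.-integrable setT f.
  apply/integrableP; split => //; rewrite -joint_int.
  rewrite ge0_integral_distribution//; last exact: measurableT_comp.
  by case/integrableP : iXY.
have iP1X : P1.-integrable setT (EFin \o X).
  by apply: integrable_pushforward => //; exact/measurable_EFinP.
have iP2Y : P2.-integrable setT (EFin \o Y).
  by apply: integrable_pushforward => //; exact/measurable_EFinP.
have eP1X : (\int[P1]_x (X x)%:E = \int[P]_w (X (U w))%:E)%E.
  by rewrite integral_distribution//; exact/measurable_EFinP.
have eP2Y : (\int[P2]_y (Y y)%:E = \int[P]_w (Y (V w))%:E)%E.
  by rewrite integral_distribution//; exact/measurable_EFinP.
have fX : (\int[P]_w (X (U w))%:E)%E \is a fin_num.
  exact: (integrable_fin_num measurableT iX).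
transitivity (\int[distribution P joint]_z f z)%E.
  by rewrite integral_distribution.
rewrite joint_int -integral21_prod_meas1// -eP2Y -(fineK fX) -integralZl//.
apply: eq_integral => y _; rewrite /fubini_G /f /= fineK// -eP1X.
under eq_integral do rewrite EFinM.
by rewrite integralZr.
Qed.

End IndependentRandomElements.

Section IndependentSigmaAlgebras.
Context (d : measure_display) (T : measurableType d) (R : realType).
Variable P : probability T R.

Lemma sub_sigma_measurable (G : set (set T)) :
  G `<=` measurable -> <<s G >> `<=` measurable.
Proof.
by move=> mG; apply: smallest_sub => //; exact: sigma_algebra_measurable.
Qed.

Lemma measurable_id_sub (G : set (set T)) : G `<=` measurable ->
  measurable_fun setT (id : T -> g_sigma_algebraType G).
Proof.
by move=> mG _ Y mY; rewrite setTI; exact: (sub_sigma_measurable mG).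
Qed.

(** The identity, seen as a random element of the space [T] with a smaller
    sigma-algebra.  Independence of two sigma-algebras is independence of the
    two random elements so obtained. *)
Definition coarsen (G : set (set T)) (mG : G `<=` measurable) :
    {RV P >-> g_sigma_algebraType G} :=
  HB.pack (id : T -> g_sigma_algebraType G)
    (isMeasurableFun.Build _ _ _ _ _ (measurable_id_sub mG)).

Variables G1 G2 : set (set T).
Hypothesis mG1 : G1 `<=` measurable.
Hypothesis mG2 : G2 `<=` measurable.
Hypothesis indep : independent_systems P <<s G1 >> <<s G2 >>.
Local Notation T1 := (g_sigma_algebraType G1).
Local Notation T2 := (g_sigma_algebraType G2).

Lemma indep_systems_tonelli (f : T1 * T2 -> \bar R) :
  measurable_fun setT f -> (forall z, 0 <= f z)%E ->
  (\int[P]_w f (w, w) = \int[P]_v \int[P]_u f (u, v))%E.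
Proof.
by move=> mf f0;
  apply: (@indep_tonelli _ _ _ _ _ P T1 T2 (coarsen mG1) (coarsen mG2)).
Qed.

Lemma measurable_partial_integral_systems (f : T1 * T2 -> \bar R) :
  measurable_fun setT f -> (forall z, 0 <= f z)%E ->
  measurable_fun setT (fun v : T => \int[P]_u f (u, v))%E.
Proof.
exact: (@measurable_partial_integral _ _ _ _ _ P T1 T2
  (coarsen mG1) (coarsen mG2)).
Qed.

Lemma indep_systems_expectationM (X : T1 -> R) (Y : T2 -> R) :
  measurable_fun setT X -> measurable_fun setT Y ->
  P.-integrable setT (fun w => (X w)%:E) ->
  P.-integrable setT (fun w => (Y w)%:E) ->
  (\int[P]_w (X w * Y w)%:E = \int[P]_w (X w)%:E * \int[P]_w (Y w)%:E)%E.
Proof.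
by move=> mX mY iX iY;
  apply: (@indep_expectationM _ _ _ _ _ P T1 T2 (coarsen mG1) (coarsen mG2)).
Qed.

End IndependentSigmaAlgebras.

Section MutualIndependence.
Context (d : measure_display) (T : measurableType d) (R : realType).
Variable P : probability T R.

(** For fixed [E1], both sides are finite measures in [E2], so that agreement
    on a pi-system extends to the sigma-algebra that it generates. *)
Lemma indep_pi_system (C : set (set T)) (E1 : set T) :
  C `<=` measurable -> setI_closed C -> C setT -> measurable E1 ->
  (forall E2, C E2 -> P (E1 `&` E2) = P E1 * P E2)%E ->
  (forall E2, <<s C >> E2 -> P (E1 `&` E2) = P E1 * P E2)%E.
Proof.
move=> mC CI CT mE1 CE E2 sE2.
have p0 : 0 <= fine (P E1) by rewrite fine_ge0.
have fE : P E1 = (fine (P E1))%:E by rewrite fineK// fin_num_measure.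
have cover : \bigcup_(k : nat) (fun=> [set: T]) k = setT.
  by apply/seteqP; split => // w _; exists 0%N.
have := @g_sigma_algebra_measure_unique _ _ _ C mC (fun=> setT) (fun=> CT)
  cover (mrestr P mE1) (mscale (NngNum p0) P) CI.
rewrite /mrestr/= /mscale/= setIC -fE; apply => //.
  by move=> A /CE; rewrite setIC.
by move=> _; rewrite /mrestr/= setTI fE ltry.
Qed.

Section Generators.
Variables (I : Type) (X : I -> {RV P >-> R}).

(** The generating sets of [sigma_generated X D], named so that the
    sigma-algebra becomes a measurable type [g_sigma_algebraType]. *)
Definition generators (D : set I) : set (set T) :=
  \bigcup_(i in D) preimage_set_system setT (X i) measurable.

Lemma measurable_generators D : generators D `<=` measurable.
Proof.
by move=> _ [i _ [B mB <-]]; exact: measurable_funP.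
Qed.

Lemma measurable_coord (D : set I) i : D i ->
  measurable_fun setT (X i : g_sigma_algebraType (generators D) -> R).
Proof.
move=> Di _ B mB; apply: sub_sigma_algebra; exists i => //.
by exists B.
Qed.

End Generators.

(** The product rule is only known for events that prescribe each coordinate
    separately.  These cylinders form a pi-system, and [indep_pi_system] is
    applied twice: first to pass from cylinders to arbitrary events of the
    coordinates other than [p], then to pass from preimages under [X p] to the
    sigma-algebra of [X p]. *)
Lemma mutually_independent_split (I : finType) (X : I -> {RV P >-> R}) (p : I) :
  mutually_independent X ->
  independent_systems P (sigma_generated X [set p])
    (sigma_generated X [set~ p]).
Proof.
move=> indX.
pose cyl (B : I -> set R) := \bigcap_(i in [set~ p]) X i @^-1` B i.
pose C := [set cyl B | B in [set B | forall i, measurable (B i)]].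
have mX i A : measurable A -> measurable (X i @^-1` A).
  by move=> mA; rewrite -[_ @^-1` _]setTI; exact: measurable_funP.
have prodE A B : measurable A -> (forall i, measurable (B i)) ->
    P (X p @^-1` A `&` cyl B) =
      (P (X p @^-1` A) * \prod_(i | i != p) P (X i @^-1` B i))%E.
  move=> mA mB; pose B' i := if i == p then A else B i.
  have mB' i : measurable (B' i) by rewrite /B'; case: ifP.
  have := indX (enum I) B' (enum_uniq I) mB'.
  rewrite big_enum/= (bigD1 p)//= {2}/B' eqxx.
  rewrite (eq_bigr (fun i => P (X i @^-1` B i))); last first.
    by move=> i /negbTE ip; rewrite /B' ip.
  move=> <-; congr (P _); apply/seteqP; split => [w [Aw Cw] i _|w Cw].
    by rewrite /B' /preimage /=; case: eqP => [->//|ip]; exact: Cw.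
  split; first by have := Cw p; rewrite /B' eqxx; apply; rewrite /= mem_enum.
  move=> i /= /eqP ip; have := Cw i; rewrite /B' (negbTE ip); apply.
  by rewrite /= mem_enum.
have CE A E2 : measurable A -> C E2 ->
    P (X p @^-1` A `&` E2) = (P (X p @^-1` A) * P E2)%E.
  move=> mA [B mB <-]; rewrite prodE//.
  have := prodE setT B measurableT mB.
  by rewrite preimage_setT setTI probability_setT mul1e => ->.
have mC : C `<=` measurable.
  move=> _ [B mB <-]; apply: fin_bigcap_measurable => // i _.
  exact: mX.
have CI : setI_closed C.
  move=> _ _ [B mB <-] [B' mB' <-]; exists (fun i => B i `&` B' i).
    by move=> i; exact: measurableI.
  apply/seteqP; split => [w BB'|w [Bw B'w] i ip].
    by split => i /BB' [].
  by split; [exact: Bw|exact: B'w].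
have CT : C setT.
  by exists (fun=> setT) => //; apply/seteqP; split => w.
have sub2 : sigma_generated X [set~ p] `<=` <<s C >>.
  apply: smallest_sub; first exact: smallest_sigma_algebra.
  move=> _ [i ip [B mB <-]]; apply: sub_sigma_algebra.
  exists (fun j => if j == i then B else setT).
    by move=> j; case: ifP.
  rewrite setTI; apply/seteqP; split => [w Bw|w Bw j jp].
    by have := Bw i ip; rewrite eqxx.
  by case: eqP => // ->.
have step1 A E2 : measurable A -> sigma_generated X [set~ p] E2 ->
    P (X p @^-1` A `&` E2) = (P (X p @^-1` A) * P E2)%E.
  move=> mA /sub2; apply: indep_pi_system => //; first exact: mX.
  by move=> E; exact: CE.
have sub1 : sigma_generated X [set~ p] `<=` measurable.
  exact/sub_sigma_measurable/measurable_generators.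
move=> E1 E2 sE1 sE2; rewrite setIC muleC.
apply: (indep_pi_system (C := generators X [set p])) => //.
- exact: measurable_generators.
- rewrite /generators bigcup_set1 => _ _ [B mB <-] [B' mB' <-].
  by exists (B `&` B'); [exact: measurableI|rewrite !setTI preimage_setI].
- by exists p => //; exists setT => //; rewrite preimage_setT setTI.
- exact: sub1.
- rewrite /generators bigcup_set1 => _ [B mB <-].
  by rewrite setTI setIC step1// muleC.
Qed.

End MutualIndependence.

(** * Moments of the standard normal law *)

Section GaussianMoments.
Variable R : realType.
Local Notation mu := (@lebesgue_measure R).
Local Notation phi := (@normal_pdf R 0 1).

Lemma normal_pdf01E x : phi x = normal_peak 1 * expR (- (x ^+ 2 / 2)).
Proof.
by rewrite normal_pdfE ?oner_neq0// /normal_fun subr0 expr1n mulNr.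
Qed.

Lemma is_derive_normal_pdf01 (x : R) : is_derive x 1 phi (- (x * phi x)).
Proof.
rewrite (_ : phi = fun x => normal_peak 1 * expR (- (x ^+ 2 / 2))); last first.
  by apply/funext => y; exact: normal_pdf01E.
apply: is_derive_eq; rewrite /GRing.scale/=.
by field.
Qed.

(** The boundary term of the integration by parts below.  One term of the
    exponential series, exp y >= y^(k+1) / (k+1)! at y = n^2 / 2, bounds
    n^(k+1) exp (- n^2 / 2) by a multiple of n^-(k+1), hence of 1 / n. *)
Lemma cvg_exprn_normal_pdf01 k :
  (fun n : nat => n%:R ^+ k.+1 * phi n%:R) @ \oo --> (0 : R).
Proof.
rewrite -cvg_shiftS /=.
pose c : R := normal_peak 1 * (k.+1`!%:R * 2 ^+ k.+1).
have c0 : 0 <= c by rewrite mulr_ge0 ?normal_peak_ge0// mulr_ge0// exprn_ge0.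
apply: (@squeeze_cvgr _ _ _ _ (fun=> 0) (fun n => c * harmonic n));
  last 2 first.
- exact: cvg_cst.
- by rewrite -[X in _ --> X](mulr0 c); apply: cvgMr => //; exact: cvg_harmonic.
apply: nearW => n; rewrite mulr_ge0 ?exprn_ge0 ?normal_pdf_ge0//=.
have n1 : 1 <= n.+1%:R :> R by rewrite ler1n.
have n0 : 0 < n.+1%:R :> R by rewrite ltr0n.
rewrite normal_pdf01E expRN.
have y0 : 0 <= n.+1%:R ^+ 2 / 2 :> R by rewrite divr_ge0// exprn_ge0.
have := expR_ge1Dxn k y0; rewrite -lerBrDl => le_exp.
have {}le_exp : (n.+1%:R ^+ 2 / 2) ^+ k.+1 / k.+1`!%:R <=
    expR (n.+1%:R ^+ 2 / 2) :> R.
  by apply: le_trans le_exp _; rewrite gerBl.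
rewrite mulrCA /c -[leRHS]mulrA ler_wpM2l ?normal_peak_ge0//.
rewrite ler_pdivrMr ?expR_gt0//.
have w0 : 0 <= k.+1`!%:R * 2 ^+ k.+1 / n.+1%:R :> R.
  by rewrite divr_ge0 ?mulr_ge0// exprn_ge0.
apply: le_trans (ler_wpM2l w0 le_exp).
rewrite expr_div_n -exprM mulnC exprM.
have f0 : k.+1`!%:R != 0 :> R by rewrite pnatr_eq0 -lt0n fact_gt0.
have -> : k.+1`!%:R * 2 ^+ k.+1 / n.+1%:R *
   ((n.+1%:R ^+ k.+1) ^+ 2 / 2 ^+ k.+1 / k.+1`!%:R) =
   n.+1%:R ^+ k.+1 * n.+1%:R ^+ k :> R.
  rewrite !(exprS _ k); field.
  by rewrite f0 expf_neq0//= nat1r gt_eqF.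
by rewrite ler_peMr ?exprn_ege1// exprn_ge0.
Qed.

Local Notation halfmoment k :=
  (\int[mu]_(x in `[0%R, +oo[) (x ^+ k * phi x)%:E)%E.

Lemma continuous_moment_integrand k : continuous (fun x : R => x ^+ k * phi x).
Proof.
move=> x; apply: cvgM; first exact: exprn_continuous.
by apply: continuous_normal_pdf; rewrite oner_neq0.
Qed.

Lemma halfmoment_ge0 k : ~~ odd k -> (0 <= halfmoment k)%E.
Proof.
move=> ek; apply: integral_ge0 => x _.
by rewrite lee_fin mulr_ge0 ?exprn_even_ge0 ?normal_pdf_ge0.
Qed.

(** The parity of [k] makes the integrand nonnegative on the whole line, which
    gives monotone convergence without any integrability. *)
Lemma cvg_halfmoment k : ~~ odd k ->
  (fun n : nat => \int[mu]_(x in `[0%R, n%:R]) (x ^+ k * phi x)%:E)%E @ \oo -->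
  halfmoment k.
Proof.
move=> ek; apply: ge0_cvgn_integral.
  by move=> x; rewrite mulr_ge0 ?exprn_even_ge0 ?normal_pdf_ge0.
apply: continuous_measurable_fun; exact: continuous_moment_integrand.
Qed.

(** Integration by parts of x^(k+1) against x phi(x), whose primitive is
    - phi(x). *)
Lemma halfmoment_by_parts k (n : nat) :
  (\int[mu]_(x in `[0%R, n.+1%:R]) (x ^+ k.+2 * phi x)%:E =
   (k.+1%:R)%:E * \int[mu]_(x in `[0%R, n.+1%:R]) (x ^+ k * phi x)%:E -
   (n.+1%:R ^+ k.+1 * phi n.+1%:R)%:E)%E.
Proof.
pose F (x : R) := x ^+ k.+1; pose f (x : R) := k.+1%:R * x ^+ k.
pose G (x : R) := - phi x; pose g (x : R) := x * phi x.
have cphi : continuous phi by apply: continuous_normal_pdf; rewrite oner_neq0.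
have cf : continuous f.
  by move=> x; apply: cvgM; [exact: cvg_cst|exact: exprn_continuous].
have cg : continuous g by move=> x; apply: cvgM; [exact: cvg_id|exact: cphi].
have cF : continuous F by exact: exprn_continuous.
have cG : continuous G by move=> x; apply: cvgN; exact: cphi.
have dF (x : R) : is_derive x 1 F (f x).
  have := @is_deriveX R R id k.+1 x 1 1 (is_derive_id x 1).
  rewrite (_ : (id : R -> R) ^+ k.+1 = F); last first.
    by apply/funext => y; rewrite fctE.
  by rewrite [_ *: _]mulr1.
have dG (x : R) : is_derive x 1 G (g x).
  have := is_derive_normal_pdf01 x => ?; rewrite /G /g.
  by apply: is_derive_eq; rewrite opprK.
have LR (H h : R -> R) : continuous H ->
    (forall x : R, is_derive x 1 H (h x)) ->
    derivable_oo_LRcontinuous H 0 n.+1%:R.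
  move=> cH dH; split; first by move=> x _; case: (dH x).
    exact/cvg_at_right_filter/cH.
  exact/cvg_at_left_filter/cH.
have := @integration_by_parts R F G f g 0 n.+1%:R (ltr0Sn _ _)
  (continuous_subspaceT cf) (LR _ _ cF dF) _
  (continuous_subspaceT cg) (LR _ _ cG dG) _.
rewrite /F /G /f /g /= expr0n mul0r subr0 mulrN => IBP.
transitivity (\int[mu]_(x in `[0%R, n.+1%:R]) (x ^+ k.+1 * (x * phi x))%:E)%E.
  by apply: eq_integral => x _; rewrite mulrA -exprSr.
rewrite IBP; last 2 first.
- by move=> x _; rewrite derive1E; have [_ ->] := dF x.
- by move=> x _; rewrite derive1E; have [_ ->] := dG x.
rewrite EFinN addeC; congr (_ - _)%E.
have ik : mu.-integrable `[0, n.+1%:R] (EFin \o (fun x => x ^+ k * phi x)).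
  apply: continuous_compact_integrable; first exact: segment_compact.
  by apply: continuous_subspaceT; exact: continuous_moment_integrand.
have -> : (\int[mu]_(x in `[0%R, n.+1%:R]) (k.+1%:R * x ^+ k * - phi x)%:E =
    \int[mu]_(x in `[0%R, n.+1%:R]) - (k.+1%:R%:E * (x ^+ k * phi x)%:E))%E.
  by apply: eq_integral => x _; rewrite mulrN -mulrA EFinN EFinM.
have Zik : mu.-integrable `[0, n.+1%:R]
    (fun x => k.+1%:R%:E * (x ^+ k * phi x)%:E)%E.
  exact: integrableZl.
rewrite integralN/= ?oppeK; first by rewrite -integralZl.
exact: integrable_add_def.
Qed.

(** Let the cut-off tend to infinity in [halfmoment_by_parts]. *)
Lemma halfmomentS k : ~~ odd k -> (halfmoment k < +oo)%E ->
  (halfmoment k.+2 = k.+1%:R%:E * halfmoment k)%E.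
Proof.
move=> ek fin_k.
have fk : halfmoment k \is a fin_num by rewrite ge0_fin_numE// halfmoment_ge0.
have ek2 : ~~ odd k.+2 by rewrite /= negbK.
have lim : (fun n : nat =>
    (k.+1%:R%:E * \int[mu]_(x in `[0%R, n.+1%:R]) (x ^+ k * phi x)%:E -
    (n.+1%:R ^+ k.+1 * phi n.+1%:R)%:E)%E) @ \oo -->
    (k.+1%:R%:E * halfmoment k)%E.
  rewrite -[X in _ --> X]sube0; apply: cvgeB.
  - by rewrite fin_num_adde_defl.
  - apply: cvgeZl => //.
    by have := cvg_halfmoment ek; rewrite -cvg_shiftS; exact.
  - apply: (cvg_EFin
      (f := fun n : nat => (n.+1%:R ^+ k.+1 * phi n.+1%:R)%:E)) => /=.
      exact: nearW.
    by have := @cvg_exprn_normal_pdf01 k; rewrite -cvg_shiftS; exact.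
have := cvg_halfmoment ek2; rewrite -cvg_shiftS /=.
under [X in X @ _ --> _]funext do rewrite halfmoment_by_parts.
by move=> /cvg_unique; apply.
Qed.

Lemma normal_moment_even k : ~~ odd k ->
  (\int[mu]_x (x ^+ k * phi x)%:E = 2%:E * halfmoment k)%E.
Proof.
move=> ek; rewrite ge0_symfun_integralT.
- by rewrite set_itvcy.
- by move=> x; rewrite mulr_ge0 ?exprn_even_ge0 ?normal_pdf_ge0.
- exact: continuous_moment_integrand.
- move=> x /=; rewrite !normal_pdf01E sqrrN exprNn -signr_odd (negbTE ek).
  by rewrite expr0 mul1r.
Qed.

Lemma halfmoment0 : (2%:E * halfmoment 0 = 1)%E.
Proof.
rewrite -normal_moment_even// -(integral_normal_pdf (0 : R) 1).
by apply: eq_integral => x _; rewrite expr0 mul1r.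
Qed.

Lemma normal_even_moments :
  (\int[mu]_x (x ^+ 2 * phi x)%:E = 1)%E /\
  (\int[mu]_x (x ^+ 4 * phi x)%:E = 3%:E)%E.
Proof.
have f0 : (halfmoment 0 < +oo)%E.
  rewrite ltey; apply/eqP => h; move: halfmoment0.
  by rewrite h gt0_muley.
have h2 := halfmomentS (k := 0) isT f0; rewrite mul1e in h2.
have h4 := halfmomentS (k := 2) isT.
rewrite !normal_moment_even// h2 halfmoment0 h4 ?h2//.
by rewrite muleCA halfmoment0 mule1.
Qed.

(** The Radon-Nikodym derivative of the normal law agrees almost everywhere
    with its density, by uniqueness. *)
Lemma ge0_integral_normal_prob (f : R -> \bar R) :
  measurable_fun setT f -> (forall x, 0 <= f x)%E ->
  (\int[normal_prob 0 1]_x f x = \int[mu]_x (f x * (phi x)%:E))%E.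
Proof.
move=> mf f0; have dom := @normal_prob_dominates R 0 1.
rewrite -(Radon_Nikodym_SigmaFinite.change_of_variables dom f0 measurableT mf).
apply: ae_eq_integral => //.
- apply: emeasurable_funM => //; apply: (measurable_int mu).
  exact: Radon_Nikodym_SigmaFinite.f_integrable.
- apply: emeasurable_funM => //; apply/measurable_EFinP.
  exact: measurable_normal_pdf.
- apply: ae_eqe_mul2l => /=; apply: integral_ae_eq => //.
  + exact: Radon_Nikodym_SigmaFinite.f_integrable.
  + by apply/measurable_EFinP; exact: measurable_normal_pdf.
  + by move=> E _ mE; rewrite -Radon_Nikodym_SigmaFinite.f_integral.
Qed.

Section StandardNormal.
Context (d : measure_display) (T : measurableType d) (P : probability T R).
Variable X : {RV P >-> R}.
Hypothesis XN : forall B : set R, measurable B ->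
  distribution P X B = normal_prob 0 1 B.

Lemma standard_normal_ge0 (f : R -> R) : measurable_fun setT f ->
  (forall x, 0 <= f x) ->
  (\int[P]_w (f (X w))%:E = \int[mu]_x (f x * phi x)%:E)%E.
Proof.
move=> mf f0.
(* [normal_prob] is a measure on [measurableTypeR R], whose measurable sets are
   those of [R] under another display. *)
have mX : measurable_fun setT (X : T -> measurableTypeR R) := measurable_funP X.
pose X' : {RV P >-> measurableTypeR R} :=
  HB.pack (X : T -> measurableTypeR R) (isMeasurableFun.Build _ _ _ _ _ mX).
transitivity (\int[distribution P X']_x (f x)%:E)%E.
  by rewrite ge0_integral_distribution//; exact/measurable_EFinP.
transitivity (\int[normal_prob 0 1]_x (f x)%:E)%E.
  by apply: eq_measure_integral => B mB _; exact: XN.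
by rewrite ge0_integral_normal_prob//; exact/measurable_EFinP.
Qed.

Lemma standard_normal_sqr : (\int[P]_w (X w ^+ 2)%:E = 1)%E.
Proof.
have [m2 _] := normal_even_moments.
rewrite (standard_normal_ge0 (f := fun x => x ^+ 2)) ?m2//.
by move=> x; exact: sqr_ge0.
Qed.

Lemma standard_normal_fourth : (\int[P]_w (X w ^+ 4)%:E = 3%:E)%E.
Proof.
have [_ m4] := normal_even_moments.
rewrite (standard_normal_ge0 (f := fun x => x ^+ 4)) ?m4//.
by move=> x; exact: exprn_even_ge0.
Qed.

(** Split X into its positive and negative parts, with means a and b.  Then
    E |X| = a + b, and also E |X| = 2 a because |x| phi(x) is even; as a is
    finite, a = b. *)
Lemma standard_normal_mean : (\int[P]_w (X w)%:E = 0)%E.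
Proof.
have mp : measurable_fun setT (fun x : R => Num.max x 0).
  exact: measurable_maxr.
have mn : measurable_fun setT (fun x : R => Num.max (- x) 0).
  by apply: measurable_maxr => //; exact: measurable_oppr.
have p0 x : 0 <= Num.max x 0 :> R by rewrite le_max lexx orbT.
have cphi : continuous phi by apply: continuous_normal_pdf; rewrite oner_neq0.
have cabs : continuous (fun x : R => `|x| * phi x).
  by move=> x; apply: cvgM; [exact: norm_continuous|exact: cphi].
have mphi : measurable_fun setT phi by exact: measurable_normal_pdf.
set a := (\int[mu]_x (Num.max x 0 * phi x)%:E)%E.
set b := (\int[mu]_x (Num.max (- x) 0 * phi x)%:E)%E.
have a0 : (0 <= a)%E.
  by apply: integral_ge0 => x _; rewrite lee_fin mulr_ge0 ?normal_pdf_ge0.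
have absE : (\int[mu]_x (`|x| * phi x)%:E = a + b)%E.
  rewrite -ge0_integralD//.
  - apply: eq_integral => x _; rewrite -EFinD -mulrDl; congr (_ * _)%:E.
    case/orP: (le_total 0 x) => x0.
      by rewrite ger0_norm// max_l// max_r ?oppr_le0// addr0.
    by rewrite ler0_norm// max_r// max_l ?oppr_ge0// add0r.
  - by move=> x _; rewrite lee_fin mulr_ge0 ?normal_pdf_ge0.
  - by apply/measurable_EFinP; exact: measurable_funM.
  - by move=> x _; rewrite lee_fin mulr_ge0 ?normal_pdf_ge0.
  - by apply/measurable_EFinP; exact: measurable_funM.
(* The integrand of [a] vanishes on the negative half-line. *)
have abs2 : (\int[mu]_x (`|x| * phi x)%:E = a + a)%E.
  rewrite ge0_symfun_integralT//.
  - rewrite -mule2n -mule_natl; congr (_ * _)%E.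
    rewrite /a [RHS](_ : _ = \int[mu]_(x in [set x : R | (0 <= x)%R])
        (Num.max x 0 * phi x)%:E)%E.
      by apply: eq_integral => x /[!inE] /= x0; rewrite ger0_norm// max_l.
    rewrite [RHS]integral_mkcond; apply: eq_integral => x _.
    rewrite patchE; case: ifPn => // /negP; rewrite inE /= => /negP.
    by rewrite -ltNge => x0; rewrite max_r ?(ltW x0)// mul0r.
  - by move=> x; rewrite mulr_ge0 ?normal_pdf_ge0.
  - by move=> x /=; rewrite normrN !normal_pdf01E sqrrN.
have afin : a \is a fin_num.
  rewrite ge0_fin_numE//.
  apply: (@le_lt_trans _ _ (\int[mu]_x (phi x + x ^+ 2 * phi x)%:E)%E).
    apply: ge0_le_integral => //.
    - by move=> x _; rewrite lee_fin mulr_ge0 ?normal_pdf_ge0.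
    - by apply/measurable_EFinP; exact: measurable_funM.
    - apply/measurable_EFinP; apply: measurable_funD => //.
      by apply: measurable_funM.
    - move=> x _; rewrite lee_fin -{2}(mul1r (phi x)) -mulrDl.
      rewrite ler_wpM2r ?normal_pdf_ge0// ge_max; apply/andP; split; nra.
  under eq_integral do rewrite EFinD.
  rewrite ge0_integralD//.
  - by rewrite integral_normal_pdf (proj1 normal_even_moments) -EFinD ltry.
  - by move=> x _; rewrite lee_fin normal_pdf_ge0.
  - exact/measurable_EFinP.
  - by move=> x _; rewrite lee_fin mulr_ge0 ?normal_pdf_ge0 ?sqr_ge0.
  - by apply/measurable_EFinP; exact: measurable_funM.
have ab : a = b.
  move: abs2; rewrite absE => /(congr1 (fun y => y - a)%E).
  by rewrite [(a + b)%E]addeC !addeK.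
rewrite integralE.
transitivity (a - b)%E; last by rewrite ab subee// -ab.
congr (_ - _)%E.
- rewrite /a -(standard_normal_ge0 mp)//; apply: eq_integral => w _.
  by rewrite funeposE -EFin_max.
- rewrite /b -(standard_normal_ge0 mn)//; apply: eq_integral => w _.
  by rewrite funenegE -EFinN -EFin_max.
Qed.

End StandardNormal.
End GaussianMoments.

(** * Joint moments of independent standard normal variables *)

Section HasMean.
Context (d : measure_display) (T : measurableType d) (R : realType).
Variable P : probability T R.

(** Integrability is part of the notion, so that means of linear combinations
    can be computed term by term without side conditions. *)
Definition has_mean (f : T -> R) (c : R) : Prop :=
  P.-integrable setT (EFin \o f) /\ (\int[P]_w (f w)%:E = c%:E)%E.

Lemma has_mean_cst c : has_mean (fun=> c) c.
Proof.
split; last by have := expectation_cst P c; rewrite unlock.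
exact: finite_measure_integrable_cst.
Qed.

Lemma has_meanD f g a b : has_mean f a -> has_mean g b ->
  has_mean (fun w => f w + g w) (a + b).
Proof.
move=> [fi fa] [gi gb]; split.
  rewrite (_ : EFin \o _ = (EFin \o f) \+ (EFin \o g))%E//.
  exact: integrableD.
by under eq_integral do rewrite EFinD; rewrite integralD// fa gb.
Qed.

Lemma has_meanZ k f a : has_mean f a -> has_mean (fun w => k * f w) (k * a).
Proof.
move=> [fi fa]; split.
  rewrite (_ : EFin \o _ = (fun w => k%:E * (EFin \o f) w))%E//.
  exact: integrableZl.
by under eq_integral do rewrite EFinM; rewrite integralZl// fa.
Qed.

Lemma has_mean_sum (I : finType) (f : I -> T -> R) (c : I -> R) :
  (forall i, has_mean (f i) (c i)) ->
  has_mean (fun w => \sum_i f i w) (\sum_i c i).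
Proof.
move=> fc.
have E : EFin \o (fun w => \sum_i f i w) = (fun w => \sum_i (f i w)%:E)%E.
  by apply/funext => w /=; rewrite sumEFin.
split.
  by rewrite E; apply: integrable_sum => // i _; exact: (fc i).1.
transitivity (\int[P]_w (\sum_i (f i w)%:E))%E.
  by apply: eq_integral => w _; rewrite sumEFin.
rewrite integral_sum//; last by move=> i; exact: (fc i).1.
by rewrite -sumEFin; apply: eq_bigr => i _; exact: (fc i).2.
Qed.

Lemma has_mean_ext f g a b : f =1 g -> a = b -> has_mean f a -> has_mean g b.
Proof. by move=> /funext -> ->. Qed.

End HasMean.

Section GaussianFamily.
Context (d : measure_display) (T : measurableType d) (R : realType).
Variable P : probability T R.
Context (I : finType) (X : I -> {RV P >-> R}).
Hypothesis XN : forall i (B : set R), measurable B ->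
  distribution P (X i) B = normal_prob 0 1 B.
Hypothesis Xindep : mutually_independent X.

Lemma integrable_fourth i : P.-integrable setT (fun w => (X i w ^+ 4)%:E).
Proof.
apply/integrableP; split.
  by apply/measurable_EFinP; exact: measurable_funX.
under eq_integral do rewrite gee0_abs ?lee_fin ?exprn_even_ge0//.
by rewrite standard_normal_fourth ?ltry//; exact: XN.
Qed.

(** Every monomial of degree at most four is dominated in this way. *)
Lemma integrable_dominated_fourth (f : T -> R) (p q r t : I) :
  measurable_fun setT f ->
  (forall w, `|f w| <= 1 + X p w ^+ 4 + X q w ^+ 4 + X r w ^+ 4 + X t w ^+ 4) ->
  P.-integrable setT (EFin \o f).
Proof.
move=> mf fX.
apply: (@le_integrable _ _ _ P setT measurableT _
  (fun w => 1%:E + (X p w ^+ 4)%:E + (X q w ^+ 4)%:E + (X r w ^+ 4)%:E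
     + (X t w ^+ 4)%:E)%E).
- exact/measurable_EFinP.
- move=> w _ /=; rewrite lee_fin; apply: le_trans (fX w) _.
  exact: ler_norm.
- do 4! (apply: integrableD => //; last exact: integrable_fourth).
  exact: finite_measure_integrable_cst.
Qed.

Lemma integrable_monomial4 p q r t :
  P.-integrable setT (EFin \o (fun w => X p w * X q w * X r w * X t w)).
Proof.
apply: (@integrable_dominated_fourth _ p q r t).
  by do 3! apply: measurable_funM => //.
move=> w; rewrite ler_norml; apply/andP.
set a := X p w; set b := X q w; set c := X r w; set e := X t w.
have sq (x y : R) : 0 <= (x ^+ 2 - y ^+ 2) ^+ 2 by exact: sqr_ge0.
have := sq a b; have := sq c e.
have h1 := sqr_ge0 (a * b + c * e); have h2 := sqr_ge0 (a * b - c * e).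
by split; nra.
Qed.

Lemma integrable_monomial2 p q :
  P.-integrable setT (EFin \o (fun w => X p w * X q w)).
Proof.
apply: (@integrable_dominated_fourth _ p q p q); first exact: measurable_funM.
move=> w; rewrite ler_norml; apply/andP.
set a := X p w; set b := X q w.
have h1 := sqr_ge0 (a ^+ 2 - 1); have h2 := sqr_ge0 (b ^+ 2 - 1).
have h3 := sqr_ge0 (a - b); have h4 := sqr_ge0 (a + b).
have h5 : 0 <= a ^+ 4 by exact: exprn_even_ge0.
have h6 : 0 <= b ^+ 4 by exact: exprn_even_ge0.
by split; nra.
Qed.

Lemma integrable_monomial3 p q r :
  P.-integrable setT (EFin \o (fun w => X p w * X q w * X r w)).
Proof.
apply: (@integrable_dominated_fourth _ p q r r).
  by do 2! apply: measurable_funM => //.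
move=> w; rewrite ler_norml; apply/andP.
set a := X p w; set b := X q w; set c := X r w.
have sq (x y : R) : 0 <= (x ^+ 2 - y ^+ 2) ^+ 2 by exact: sqr_ge0.
have := sq a b; have := sq c 1.
have h1 := sqr_ge0 (a * b + c); have h2 := sqr_ge0 (a * b - c).
have h6 : 0 <= c ^+ 4 by exact: exprn_even_ge0.
by split; nra.
Qed.

Lemma integrable_monomial1 p : P.-integrable setT (EFin \o X p).
Proof.
apply: (@integrable_dominated_fourth _ p p p p) => // w.
rewrite ler_norml; apply/andP.
set a := X p w.
have h1 := sqr_ge0 (a ^+ 2 - 1); have h2 := sqr_ge0 (a - 1).
have h3 := sqr_ge0 (a + 1).
have h5 : 0 <= a ^+ 4 by exact: exprn_even_ge0.
by split; nra.
Qed.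

Lemma indep_one_other (p : I) (f g : T -> R) :
  measurable_fun setT (f : g_sigma_algebraType (generators X [set p]) -> R) ->
  measurable_fun setT (g : g_sigma_algebraType (generators X [set~ p]) -> R) ->
  P.-integrable setT (EFin \o f) -> P.-integrable setT (EFin \o g) ->
  (\int[P]_w (f w * g w)%:E = \int[P]_w (f w)%:E * \int[P]_w (g w)%:E)%E.
Proof.
move=> mf mg fi gi.
apply: (indep_systems_expectationM
  (measurable_generators (X := X) (D := [set p]))
  (measurable_generators (X := X) (D := [set~ p]))) => //.
exact: mutually_independent_split.
Qed.

Lemma has_mean2 p q : has_mean P (fun w => X p w * X q w) (p == q)%:R.
Proof.
split; first exact: integrable_monomial2.
have [<-{q}|pq] := eqVneq p q.
  under eq_integral do rewrite -expr2.
  by rewrite standard_normal_sqr//; exact: XN.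
rewrite (@indep_one_other p).
- by rewrite standard_normal_mean ?mul0e//; exact: XN.
- exact: measurable_coord.
- by apply: measurable_coord => /= qp; rewrite qp eqxx in pq.
- exact: integrable_monomial1.
- exact: integrable_monomial1.
Qed.

(** A factor that occurs only once splits off by independence and has mean
    zero. *)
Lemma mean4_isolated p q r t : p != q -> p != r -> p != t ->
  (\int[P]_w (X p w * (X q w * X r w * X t w))%:E = 0)%E.
Proof.
move=> pq pr pt.
have ne i : p != i -> [set~ p] i by move=> pi /= ip; rewrite ip eqxx in pi.
rewrite (@indep_one_other p).
- by rewrite standard_normal_mean ?mul0e//; exact: XN.
- exact: measurable_coord.
- have mX i : p != i ->
      measurable_fun setT
        (X i : g_sigma_algebraType (generators X [set~ p]) -> R).
    by move=> pi; apply: measurable_coord; exact: ne.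
  by apply: measurable_funM; [apply: measurable_funM|]; exact: mX.
- exact: integrable_monomial1.
- exact: integrable_monomial3.
Qed.

Lemma mean4_two_squares p r : p != r ->
  (\int[P]_w (X p w ^+ 2 * X r w ^+ 2)%:E = 1)%E.
Proof.
move=> pr; rewrite (@indep_one_other p).
- by rewrite !standard_normal_sqr ?mule1//; exact: XN.
- by apply: measurable_funX; exact: measurable_coord.
- apply: measurable_funX; apply: measurable_coord => /= rp.
  by rewrite rp eqxx in pr.
- have := integrable_monomial2 p p.
  by apply: eq_integrable => // w _ /=; rewrite expr2.
- have := integrable_monomial2 r r.
  by apply: eq_integrable => // w _ /=; rewrite expr2.
Qed.

(** Wick's formula for four factors.  If some index occurs only once, both
    sides vanish by [mean4_isolated]; otherwise the indices form two pairs, and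
    the mean is 1 or, when the pairs coincide, E X^4 = 3, which is the number of
    pairings. *)
Lemma has_mean4 p q r t : has_mean P (fun w => X p w * X q w * X r w * X t w)
  (((p == q) && (r == t))%:R + ((p == r) && (q == t))%:R
   + ((p == t) && (q == r))%:R).
Proof.
split; first exact: integrable_monomial4.
have iso p' q' r' t' : (forall w, X p w * X q w * X r w * X t w =
      X p' w * (X q' w * X r' w * X t' w)) ->
    p' != q' -> p' != r' -> p' != t' ->
    (\int[P]_w (X p w * X q w * X r w * X t w)%:E = 0)%E.
  move=> E *; under eq_integral do rewrite E; exact: mean4_isolated.
have two p' r' : (forall w, X p w * X q w * X r w * X t w =
      X p' w ^+ 2 * X r' w ^+ 2) -> p' != r' ->
    (\int[P]_w (X p w * X q w * X r w * X t w)%:E = 1)%E.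
  move=> E *; under eq_integral do rewrite E; exact: mean4_two_squares.
have [pq|pq] := eqVneq p q.
  have [rt|rt] := eqVneq r t.
    have [pr|pr] := eqVneq p r.
      subst q t r; rewrite !eqxx/=.
      transitivity (\int[P]_w (X p w ^+ 4)%:E)%E.
        by apply: eq_integral => w _; congr EFin; ring.
      by rewrite standard_normal_fourth; [congr EFin; ring | exact: XN].
    subst q t; rewrite (negbTE pr) !addr0.
    by apply: (two p r) => // w; ring.
  have [pr|pr] := eqVneq p r.
    subst q r; rewrite (negbTE rt) /= !add0r.
    by apply: (iso t p p p) => [w|||]; rewrite 1?eq_sym//; ring.
  subst q; rewrite (negbTE pr) !andbF !addr0.
  by apply: (iso r p p t) => [w|||//]; rewrite 1?eq_sym//; ring.
have [pr|pr] := eqVneq p r.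
  subst r; rewrite (negbTE (_ : q != p)) 1?eq_sym// andbF addr0 add0r.
  have [qt|qt] := eqVneq q t.
    by subst t; apply: (two p q) => // w; ring.
  by apply: (iso q p p t) => [w|||//]; rewrite 1?eq_sym//; ring.
have [pt|pt] := eqVneq p t.
  subst t; rewrite !add0r /=.
  have [qr|qr] := eqVneq q r.
    by subst r; apply: (two p q) => // w; ring.
  by apply: (iso q p r p) => [w||//|]; rewrite 1?eq_sym//; ring.
by rewrite !add0r; apply: (iso p q r t) => // w; ring.
Qed.

End GaussianFamily.

(** * Euclidean, operator and Frobenius norms *)

Section EuclideanNorm.
Variable R : realType.

Local Notation dot x y := ((x^T *m y) 0 0).

Lemma dotE n (x y : 'cV[R]_n) : dot x y = \sum_i x i 0 * y i 0.
Proof. by rewrite mxE; apply: eq_bigr => i _; rewrite mxE. Qed.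

Lemma dotC n (x y : 'cV[R]_n) : dot x y = dot y x.
Proof. by rewrite !dotE; apply: eq_bigr => i _; rewrite mulrC. Qed.

Lemma dotBr n (x y z : 'cV[R]_n) : dot x (y - z) = dot x y - dot x z.
Proof. by rewrite mulmxBr !mxE. Qed.

Lemma dotZr n c (x y : 'cV[R]_n) : dot x (c *: y) = c * dot x y.
Proof. by rewrite -scalemxAr !mxE. Qed.

Lemma dotBl n (x y z : 'cV[R]_n) : dot (x - y) z = dot x z - dot y z.
Proof. by rewrite [LHS]dotC dotBr [dot z x]dotC [dot z y]dotC. Qed.

Lemma dotZl n c (x y : 'cV[R]_n) : dot (c *: x) y = c * dot x y.
Proof. by rewrite [LHS]dotC dotZr [dot y x]dotC. Qed.

Lemma norm2_ge0 n (x : 'cV[R]_n) : 0 <= norm2 x.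
Proof. exact: sqrtr_ge0. Qed.

Lemma norm2_sqr n (x : 'cV[R]_n) : norm2 x ^+ 2 = \sum_i x i 0 ^+ 2.
Proof. by rewrite sqr_sqrtr// sumr_ge0// => i _; exact: sqr_ge0. Qed.

Lemma norm2_sqr_dot n (x : 'cV[R]_n) : norm2 x ^+ 2 = dot x x.
Proof. by rewrite norm2_sqr dotE; apply: eq_bigr => i _; rewrite expr2. Qed.

Lemma norm2_0 n : norm2 (0 : 'cV[R]_n) = 0.
Proof. by apply/eqP; rewrite -sqrf_eq0 norm2_sqr_dot mulmx0 mxE. Qed.

Lemma norm2_eq0 n (x : 'cV[R]_n) : (norm2 x == 0) = (x == 0).
Proof.
apply/eqP/eqP => [x0|->]; last exact: norm2_0.
apply/matrixP => i j; rewrite ord1 mxE.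
have := norm2_sqr x; rewrite x0 expr0n /= => /esym/eqP.
rewrite psumr_eq0 => [/allP/(_ i)|k _]; last exact: sqr_ge0.
by rewrite mem_index_enum sqrf_eq0 => /(_ isT)/eqP.
Qed.

Lemma norm2Z n c (x : 'cV[R]_n) : norm2 (c *: x) = `|c| * norm2 x.
Proof.
apply/eqP; rewrite -(@eqrXn2 _ 2) ?mulr_ge0 ?norm2_ge0// exprMn.
rewrite real_normK ?num_real// !norm2_sqr mulr_sumr.
by apply/eqP/eq_bigr => i _; rewrite mxE exprMn.
Qed.

(** Expand |z|^2 >= 0 for z = |y|^2 x - <x, y> y and divide by |y|^2. *)
Lemma cauchy_schwarz n (x y : 'cV[R]_n) :
  dot x y ^+ 2 <= norm2 x ^+ 2 * norm2 y ^+ 2.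
Proof.
have [->|y0] := eqVneq y 0; first by rewrite mulmx0 mxE norm2_0 expr0n mulr0.
have ygt0 : 0 < norm2 y ^+ 2.
  by rewrite exprn_gt0// lt_def norm2_eq0 y0 norm2_ge0.
pose z := norm2 y ^+ 2 *: x - dot x y *: y.
have : 0 <= norm2 z ^+ 2 by exact: sqr_ge0.
have -> : norm2 z ^+ 2 =
    norm2 y ^+ 2 * (norm2 x ^+ 2 * norm2 y ^+ 2 - dot x y ^+ 2).
  rewrite [in LHS]norm2_sqr_dot /z !(dotBl, dotBr, dotZl, dotZr).
  by rewrite -!norm2_sqr_dot [dot y x]dotC; ring.
by rewrite pmulr_rge0// subr_ge0.
Qed.

Lemma dot_le n (x y : 'cV[R]_n) : dot x y <= norm2 x * norm2 y.
Proof.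
apply: le_trans (ler_norm _) _.
rewrite -(@ler_pXn2r _ 2) ?nnegrE ?mulr_ge0 ?norm2_ge0//.
by rewrite real_normK ?num_real// exprMn cauchy_schwarz.
Qed.

Lemma frobnorm_ge0 m n (A : 'M[R]_(m, n)) : 0 <= frobnorm A.
Proof. exact: sqrtr_ge0. Qed.

Lemma frobnorm_sqr m n (A : 'M[R]_(m, n)) :
  frobnorm A ^+ 2 = \sum_j \sum_i A i j ^+ 2.
Proof.
have trE : \tr (A^T *m A) = \sum_j \sum_i A i j ^+ 2.
  apply: eq_bigr => j _; rewrite mxE.
  by apply: eq_bigr => i _; rewrite mxE expr2.
rewrite sqr_sqrtr trE// sumr_ge0// => j _.
by rewrite sumr_ge0// => i _; exact: sqr_ge0.
Qed.

Lemma norm2_mulmx_frob m n (A : 'M[R]_(m, n)) x :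
  norm2 (A *m x) <= frobnorm A * norm2 x.
Proof.
rewrite -(@ler_pXn2r _ 2) ?nnegrE ?mulr_ge0 ?norm2_ge0 ?frobnorm_ge0//.
rewrite exprMn norm2_sqr frobnorm_sqr exchange_big mulr_suml ler_sum// => i _.
have -> : (A *m x) i 0 = dot (row i A)^T x.
  by rewrite trmxK -row_mul [RHS]mxE.
apply: le_trans (cauchy_schwarz _ _) _.
rewrite ler_wpM2r ?sqr_ge0// norm2_sqr le_eqVlt; apply/orP; left; apply/eqP.
by apply: eq_bigr => j _; rewrite !mxE.
Qed.

Lemma unit_sphere_neq0 n : (0 < n)%N -> exists x : 'cV[R]_n, norm2 x = 1.
Proof.
case: n => // n _; exists (delta_mx 0 0); apply/eqP.
rewrite -(@eqrXn2 _ 2) ?norm2_ge0// expr1n norm2_sqr (bigD1 0)//= big1.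
  by rewrite mxE !eqxx expr1n addr0.
by move=> i /negbTE i0; rewrite mxE i0 expr0n.
Qed.

Lemma cV0_norm2 (x : 'cV[R]_0) : norm2 x = 0.
Proof. by apply/eqP; rewrite norm2_eq0; apply/eqP/matrixP => -[]. Qed.

Lemma norm2_normalize n (x : 'cV[R]_n) : x != 0 ->
  norm2 ((norm2 x)^-1 *: x) = 1.
Proof.
move=> x0; rewrite norm2Z ger0_norm ?invr_ge0 ?norm2_ge0//.
by rewrite mulVf// norm2_eq0.
Qed.

Lemma opnorm_ub m n (A : 'M[R]_(m, n)) x :
  norm2 (A *m x) <= opnorm A * norm2 x.
Proof.
have [->|x0] := eqVneq x 0; first by rewrite mulmx0 !norm2_0 mulr0.
have xgt0 : 0 < norm2 x by rewrite lt_def norm2_eq0 x0 norm2_ge0.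
rewrite -ler_pdivrMr// mulrC -[(norm2 x)^-1]ger0_norm ?invr_ge0 ?norm2_ge0//.
rewrite -norm2Z scalemxAr; apply: sup_upper_bound; last first.
  by exists ((norm2 x)^-1 *: x) => //=; exact: norm2_normalize.
split; first by exists (norm2 (A *m ((norm2 x)^-1 *: x)));
  exists ((norm2 x)^-1 *: x) => //=; exact: norm2_normalize.
exists (frobnorm A) => _ [y /= y1 <-].
by have := norm2_mulmx_frob A y; rewrite y1 mulr1.
Qed.

Lemma opnorm_ge0 m n (A : 'M[R]_(m, n)) : 0 <= opnorm A.
Proof.
case: n A => [|n] A.
  rewrite /opnorm (_ : [set _ | _ in _] = set0) ?sup0//.
  apply/seteqP; split => // y [x /=].
  by rewrite cV0_norm2 => /esym/eqP; rewrite oner_eq0.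
have [x x1] := @unit_sphere_neq0 n.+1 isT.
by have := opnorm_ub A x; rewrite x1 mulr1; apply: le_trans; exact: norm2_ge0.
Qed.

Lemma opnorm_le_frob m n (A : 'M[R]_(m, n)) : opnorm A <= frobnorm A.
Proof.
case: n A => [|n] A.
  rewrite /opnorm (_ : [set _ | _ in _] = set0) ?sup0 ?frobnorm_ge0//.
  apply/seteqP; split => // y [x /=].
  by rewrite cV0_norm2 => /esym/eqP; rewrite oner_eq0.
have [x x1] := @unit_sphere_neq0 n.+1 isT.
apply: ge_sup; first by exists (norm2 (A *m x)); exists x.
by move=> _ [y /= y1 <-]; have := norm2_mulmx_frob A y; rewrite y1 mulr1.
Qed.

(** With y = A^T a, |y|^2 = <A y, a> <= |A| |y| |a|. *)
Lemma opnorm_tr m n (A : 'M[R]_(m, n)) a :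
  norm2 (A^T *m a) <= opnorm A * norm2 a.
Proof.
have [y0|y0] := eqVneq (norm2 (A^T *m a)) 0.
  by rewrite y0 mulr_ge0 ?opnorm_ge0 ?norm2_ge0.
have ygt0 : 0 < norm2 (A^T *m a) by rewrite lt_def y0 norm2_ge0.
rewrite -(ler_pM2l ygt0) -expr2 norm2_sqr_dot trmx_mul trmxK -mulmxA.
apply: le_trans (dot_le _ _) _; rewrite mulrC.
rewrite [leRHS]mulrA [X in _ <= X * _]mulrC ler_wpM2r ?norm2_ge0//.
exact: opnorm_ub.
Qed.

End EuclideanNorm.

(** * The smallest singular value *)

Section SmallestSingularValue.
Variable R : realType.
Local Notation dot x y := ((x^T *m y) 0 0).

Lemma psd_dot_ge0 n (C : 'M[R]_n) (x : 'cV[R]_n) : psd C -> 0 <= dot x (C *m x).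
Proof. by move=> [_ /(_ x)]; rewrite mulmxA. Qed.

Lemma sym_dotC n (C : 'M[R]_n) (x y : 'cV[R]_n) : C^T = C ->
  dot x (C *m y) = dot y (C *m x).
Proof. by move=> Cs; rewrite dotC trmx_mul Cs mulmxA. Qed.

(** With y = C x, the quadratic form is nonnegative at x - t y for every t.
    This is a polynomial in t whose coefficients are <x, C x>, |y|^2 and
    <y, C y> <= |C|_F |y|^2; take t = 1 / |C|_F. *)
Lemma psd_mulmx_sqr n (C : 'M[R]_n) (x : 'cV[R]_n) : psd C ->
  norm2 (C *m x) ^+ 2 <= frobnorm C * dot x (C *m x).
Proof.
move=> Cpsd; have [Csym _] := Cpsd; set y := C *m x.
have q t : 0 <= dot (x - t *: y) (C *m (x - t *: y)) by exact: psd_dot_ge0.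
pose a := dot x y; pose b := norm2 y ^+ 2; pose c := dot y (C *m y).
have qE t : 0 <= a - t * b *+ 2 + t ^+ 2 * c.
  move: (q t); rewrite mulmxBr -scalemxAr -/y !(dotBl, dotBr, dotZl, dotZr).
  have -> : dot x (C *m y) = b by rewrite sym_dotC// -norm2_sqr_dot.
  rewrite -norm2_sqr_dot -/a -/b -/c.
  by rewrite (_ : _ - _ = a - t * b *+ 2 + t ^+ 2 * c)//; ring.
have cle : c <= frobnorm C * b.
  apply: le_trans (dot_le _ _) _.
  rewrite /b expr2 mulrCA ler_wpM2l ?norm2_ge0//.
  exact: norm2_mulmx_frob.
have a0 : 0 <= a by exact: psd_dot_ge0.
have F0 := frobnorm_ge0 C.
have b0 : 0 <= b by exact: sqr_ge0.
have [F1|F1] := eqVneq (frobnorm C) 0.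
  have y0 : norm2 y = 0.
    apply/eqP; rewrite eq_le norm2_ge0 andbT.
    by have := norm2_mulmx_frob C x; rewrite F1 mul0r.
  by rewrite -/a F1 mul0r y0 expr0n.
have Fgt0 : 0 < frobnorm C by rewrite lt_def F1.
have := qE (frobnorm C)^-1; rewrite -/a -/b => h.
have h2 : (frobnorm C)^-1 ^+ 2 * c <= (frobnorm C)^-1 * b.
  rewrite expr2 -mulrA ler_pM2l ?invr_gt0//.
  by rewrite ler_pdivrMl.
have h3 : (frobnorm C)^-1 * b <= a by lra.
by rewrite -ler_pdivrMl.
Qed.

Lemma singular_eigenvalue n (B : 'M[R]_n) a : B - a%:M \notin unitmx ->
  eigenvalue B a.
Proof. by rewrite /eigenvalue /eigenspace kermx_eq0 -row_free_unit. Qed.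

Lemma psd_eigenvalue_ge0 n (B : 'M[R]_n) a : psd B -> eigenvalue B a -> 0 <= a.
Proof.
move=> Bpsd /eigenvalueP[v vB v0].
have := psd_dot_ge0 v^T Bpsd; have [Bs _] := Bpsd.
have -> : B *m v^T = a *: v^T by rewrite -{1}Bs -trmx_mul vB linearZ.
rewrite dotZr -norm2_sqr_dot pmulr_lge0// exprn_gt0// lt_def norm2_ge0 andbT.
by rewrite norm2_eq0 trmx_eq0.
Qed.

(** Let C = B - q, where q is the infimum of the Rayleigh quotient; C is
    positive semidefinite.  If C were invertible, then
    |x|^2 <= K |C x|^2 <= K' <x, C x> for some constants by [psd_mulmx_sqr], so
    that the quotient would stay above q + 1 / K', contradicting the choice of
    q. *)
Lemma rayleigh_inf_eigenvalue n (B : 'M[R]_n) : (0 < n)%N -> psd B ->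
  let q := [set dot x (B *m x) | x in [set x : 'cV[R]_n | norm2 x = 1]] in
  eigenvalue B (inf q) /\ forall x, inf q * norm2 x ^+ 2 <= dot x (B *m x).
Proof.
move=> n0 Bpsd q.
have q0 : q !=set0.
  by have [x x1] := @unit_sphere_neq0 R n n0; exists (dot x (B *m x)); exists x.
have qlb : has_lbound q.
  by exists 0 => _ [x _ <-]; exact: psd_dot_ge0.
have rayleigh x : inf q * norm2 x ^+ 2 <= dot x (B *m x).
  have [->|x0] := eqVneq x 0; first by rewrite norm2_0 expr0n mulr0 !mulmx0 mxE.
  have xgt0 : 0 < norm2 x by rewrite lt_def norm2_eq0 x0 norm2_ge0.
  rewrite -ler_pdivlMr ?exprn_gt0//; apply: inf_lbound => //.
  exists ((norm2 x)^-1 *: x); first exact: norm2_normalize.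
  by rewrite -scalemxAr dotZl dotZr mulrA -expr2 exprVn mulrC.
split => //; apply: singular_eigenvalue; apply/negP => Cunit.
set C := B - _ in Cunit.
have Cdot x : dot x (C *m x) = dot x (B *m x) - inf q * norm2 x ^+ 2.
  by rewrite mulmxBl mul_scalar_mx dotBr dotZr -norm2_sqr_dot.
have Cpsd : psd C.
  split; first by have [Bs _] := Bpsd; rewrite raddfB/= Bs tr_scalar_mx.
  by move=> x; rewrite -mulmxA Cdot subr_ge0.
pose K := frobnorm (invmx C) ^+ 2 * frobnorm C.
have lowK x : norm2 x = 1 -> 1 <= K * (dot x (B *m x) - inf q).
  move=> x1; have := norm2_mulmx_frob (invmx C) (C *m x).
  rewrite mulKmx// x1 => h.
  have h2 : 1 <= frobnorm (invmx C) ^+ 2 * norm2 (C *m x) ^+ 2.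
    by rewrite -exprMn exprn_ege1.
  apply: le_trans h2 _; rewrite /K -mulrA ler_wpM2l ?sqr_ge0//.
  by apply: le_trans (psd_mulmx_sqr _ Cpsd) _; rewrite Cdot x1 expr1n mulr1.
have K0 : 0 < K.
  rewrite lt_def mulr_ge0 ?sqr_ge0 ?frobnorm_ge0// andbT; apply/negP => /eqP K0.
  have [x x1] := @unit_sphere_neq0 R n n0.
  by have := lowK x x1; rewrite K0 mul0r ler10.
have : inf q + K^-1 <= inf q.
  apply: lb_le_inf => // _ [x /= x1 <-].
  by rewrite -lerBrDl -[K^-1]mul1r ler_pdivrMr// mulrC lowK.
by rewrite gerDl leNgt invr_gt0 K0.
Qed.

Lemma psd0 n : psd (0 : 'M[R]_n).
Proof. by split; [exact: trmx0|move=> x; rewrite mulmx0 mul0mx mxE]. Qed.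

(** For a square root B of A^T A, |B x|^2 = x^T A^T A x = |A x|^2; for the
    default value 0 of [psd_sqrt] both claims are immediate. *)
Lemma psd_sqrt_spec m n (A : 'M[R]_(m, n)) (B := psd_sqrt (A^T *m A)) :
  psd B /\ forall x, norm2 (B *m x) <= norm2 (A *m x).
Proof.
rewrite /B /psd_sqrt; case: xgetP => [{}B _ [Bpsd BB]|_]; last first.
  split; first exact: psd0.
  by move=> x; rewrite mul0mx norm2_0 norm2_ge0.
split => // x; have [Bs _] := Bpsd.
suff : norm2 (B *m x) ^+ 2 = norm2 (A *m x) ^+ 2.
  by move=> /eqP; rewrite eqrXn2 ?norm2_ge0// => /eqP ->.
by rewrite !norm2_sqr_dot !trmx_mul Bs -!mulmxA !(mulmxA B) BB -mulmxA.
Qed.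

Lemma sigma_min_ge0 m n (A : 'M[R]_(m, n)) : 0 <= sigma_min A.
Proof.
have [Bpsd _] := psd_sqrt_spec A; rewrite /sigma_min.
set E := (X in inf X).
have [->|/set0P E0] := eqVneq E set0; first by rewrite inf0.
by apply: lb_le_inf => // a; exact: psd_eigenvalue_ge0.
Qed.

(** By [rayleigh_inf_eigenvalue] the smallest eigenvalue of the square root B
    is a lower bound of its Rayleigh quotient, and
    <x, B x> <= |x| |B x| <= |x| |A x|. *)
Lemma sigma_min_lb m n (A : 'M[R]_(m, n)) x :
  sigma_min A * norm2 x <= norm2 (A *m x).
Proof.
have [->|x0] := eqVneq x 0; first by rewrite norm2_0 mulr0 norm2_ge0.
have n0 : (0 < n)%N.
  by case: n x x0 {A} => // x; rewrite -norm2_eq0 cV0_norm2 eqxx.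
have xgt0 : 0 < norm2 x by rewrite lt_def norm2_eq0 x0 norm2_ge0.
have [Bpsd BA] := psd_sqrt_spec A.
have [eig rayleigh] := rayleigh_inf_eigenvalue n0 Bpsd.
apply: le_trans (BA x); rewrite -(ler_pM2l xgt0).
apply: le_trans (dot_le x _).
apply: le_trans (rayleigh x).
rewrite mulrCA -expr2 ler_wpM2r ?sqr_ge0//.
apply: inf_lbound => //; exists 0 => a; exact: psd_eigenvalue_ge0.
Qed.

End SmallestSingularValue.

(** * The projection onto the row space of a matrix *)

Section MoorePenrose.
Variable R : realType.
Local Notation dot x y := ((x^T *m y) 0 0).

(** C^T C u = 0 implies |C u|^2 = 0. *)
Lemma gram_unitmx m n (C : 'M[R]_(m, n)) : row_full C -> C^T *m C \in unitmx.
Proof.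
move=> Cfull; rewrite -row_free_unit -kermx_eq0; apply/eqP.
apply/row_matrixP => i; rewrite row0; set v := row i _.
have vG : v *m (C^T *m C) = 0.
  by rewrite -row_mul mulmx_ker row0.
have Cv : C *m v^T = 0.
  apply/eqP; rewrite -norm2_eq0 -sqrf_eq0 norm2_sqr_dot trmx_mul trmxK.
  by rewrite mulmxA -(mulmxA v) vG mul0mx mxE.
have CTfree : row_free C^T by rewrite /row_free mxrank_tr.
apply: (row_free_inj CTfree).
by rewrite mul0mx -[v *m _]trmxK trmx_mul trmxK Cv trmx0.
Qed.

(** The classical formula W^T (W W^T)^-1 (C^T C)^-1 C^T for the pseudo-inverse
    of C W; with [mulmx_base] it applies to every matrix. *)
Lemma penrose_full_rank_factorization m n r
    (C : 'M[R]_(m, r)) (W : 'M[R]_(r, n)) :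
  row_full C -> row_free W ->
  penrose (C *m W) (W^T *m invmx (W *m W^T) *m (invmx (C^T *m C) *m C^T)).
Proof.
move=> Cfull Wfree.
have Cu : C^T *m C \in unitmx by exact: gram_unitmx.
have Wu : W *m W^T \in unitmx.
  by rewrite -[W in W *m _]trmxK gram_unitmx// /row_full mxrank_tr.
set X := _ *m _ *m _.
have MX : C *m W *m X = C *m invmx (C^T *m C) *m C^T.
  by rewrite /X -!mulmxA (mulmxA W W^T) mulKVmx.
have XM : X *m (C *m W) = W^T *m invmx (W *m W^T) *m W.
  by rewrite /X -!mulmxA (mulmxA C^T C) mulKmx.
split.
- by rewrite MX -!mulmxA (mulmxA C^T C) mulKmx.
- by rewrite XM /X -!mulmxA (mulmxA W W^T) mulKVmx.
- by rewrite MX !trmx_mul trmxK trmx_inv trmx_mul trmxK mulmxA.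
- by rewrite XM !trmx_mul trmxK trmx_inv trmx_mul trmxK mulmxA.
Qed.

Lemma penrose_exists m n (M : 'M[R]_(m, n)) : exists X, penrose M X.
Proof.
have := penrose_full_rank_factorization (col_base_full M) (row_base_free M).
by rewrite mulmx_base => MX; eexists; exact: MX.
Qed.

Lemma moore_penroseP m n (M : 'M[R]_(m, n)) : penrose M (moore_penrose M).
Proof.
by have [X MX] := penrose_exists M; exact: (xgetPex 0 (ex_intro _ X MX)).
Qed.

Section RowProjection.
Variables (m n : nat) (M : 'M[R]_(m, n)).
Local Notation Pi := (moore_penrose M *m M).

Lemma mulmx_rowproj : M *m Pi = M.
Proof. by rewrite mulmxA; have [-> _ _ _] := moore_penroseP M. Qed.

Lemma rowproj_tr : Pi^T = Pi.
Proof. by have [_ _ _] := moore_penroseP M. Qed.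

Lemma rowproj_idem : Pi *m Pi = Pi.
Proof. by rewrite -mulmxA mulmx_rowproj. Qed.

Lemma rowproj_contract (z : 'cV[R]_n) :
  norm2 ((1%:M - Pi) *m z) ^+ 2 <= norm2 z ^+ 2.
Proof.
have PP : dot (Pi *m z) (Pi *m z) = dot z (Pi *m z).
  by rewrite trmx_mul rowproj_tr -(mulmxA z^T) (mulmxA Pi Pi) rowproj_idem.
rewrite mulmxBl mul1mx !norm2_sqr_dot !(dotBl, dotBr) PP [dot (Pi *m z) z]dotC.
rewrite subrr subr0 gerBl -PP -norm2_sqr_dot; exact: sqr_ge0.
Qed.

(** 1 - Pi is an orthogonal projection and kills the row space of M, so that
    (1 - Pi) e = (1 - Pi) (e - M^T y) is not longer than e - M^T y. *)
Lemma rowproj_best (e : 'cV[R]_n) (y : 'cV[R]_m) :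
  norm2 ((1%:M - Pi) *m e) ^+ 2 <= norm2 (e - M^T *m y) ^+ 2.
Proof.
suff -> : (1%:M - Pi) *m e = (1%:M - Pi) *m (e - M^T *m y).
  exact: rowproj_contract.
rewrite mulmxBr (mulmxA _ M^T); suff -> : (1%:M - Pi) *m M^T = 0.
  by rewrite mul0mx subr0.
rewrite mulmxBl mul1mx -{1}rowproj_tr -trmx_mul mulmx_rowproj; exact: subrr.
Qed.

(** Pi factors through M^T M, with Y = X X^T for the pseudo-inverse X.  This
    is what makes the resolvent below small on the range of Pi. *)
Lemma rowproj_gram : exists Y, Pi = M^T *m M *m Y.
Proof.
have [_ XMX MXs XMs] := moore_penroseP M.
set X := moore_penrose M in XMX MXs XMs *.
have XT : X^T = M *m X *m X^T by rewrite -{1}XMX -mulmxA trmx_mul MXs.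
exists (X *m X^T); rewrite -[LHS]XMs trmx_mul {1}XT.
by rewrite -!mulmxA.
Qed.

Lemma gram_resolvent_unit c : 0 <= c -> 1%:M + c *: (M^T *m M) \in unitmx.
Proof.
move=> c0; rewrite -row_free_unit -kermx_eq0; apply/eqP.
apply/row_matrixP => i; rewrite row0; set v := row i _.
have : v *m (1%:M + c *: (M^T *m M)) = 0.
  by rewrite -row_mul mulmx_ker row0.
move=> /(congr1 (fun u => (u *m v^T) 0 0)).
rewrite mulmxDr mulmx1 mulmxDl mul0mx [RHS]mxE [LHS]mxE.
rewrite -scalemxAr -scalemxAl [X in _ + X]mxE.
have -> : (v *m v^T) 0 0 = norm2 v^T ^+ 2 by rewrite norm2_sqr_dot trmxK.
have -> : (v *m (M^T *m M) *m v^T) 0 0 = norm2 (M *m v^T) ^+ 2.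
  by rewrite norm2_sqr_dot trmx_mul trmxK !mulmxA.
move=> /eqP; rewrite (paddr_eq0 (sqr_ge0 _) (mulr_ge0 c0 (sqr_ge0 _))).
rewrite sqrf_eq0 norm2_eq0.
by rewrite trmx_eq0 => /andP[/eqP].
Qed.

(** If z = (1 + c M^T M)^-1 y, then <z, y> = |z|^2 + c |M z|^2 >= |z|^2. *)
Lemma gram_resolvent_contract c (y : 'cV[R]_n) : 0 <= c ->
  norm2 (invmx (1%:M + c *: (M^T *m M)) *m y) <= norm2 y.
Proof.
move=> c0; set N := 1%:M + _; set z := invmx N *m y.
have Nu : N \in unitmx := gram_resolvent_unit c0.
have yE : y = z + c *: (M^T *m (M *m z)).
  by rewrite -[LHS](mulKVmx Nu) -/z mulmxDl mul1mx -scalemxAl -mulmxA.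
have [z0|z0] := eqVneq (norm2 z) 0; first by rewrite z0 norm2_ge0.
have zgt0 : 0 < norm2 z by rewrite lt_def z0 norm2_ge0.
rewrite -(ler_pM2l zgt0) -expr2; apply: le_trans (dot_le z y).
rewrite [in leRHS]yE mulmxDr [leRHS]mxE dotZr -norm2_sqr_dot lerDl.
rewrite mulr_ge0// (mulmxA z^T) -trmx_mul -norm2_sqr_dot; exact: sqr_ge0.
Qed.

Lemma norm2_coord (p : nat) (x : 'cV[R]_p) i : `|x i 0| <= norm2 x.
Proof.
rewrite -(@ler_pXn2r _ 2) ?nnegrE ?norm2_ge0// real_normK ?num_real//.
rewrite norm2_sqr (bigD1 i)//= lerDl sumr_ge0// => j _; exact: sqr_ge0.
Qed.

(** With N = (1 + c G)^-1 and G = M^T M, N fixes the range of 1 - Pi, where G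
    vanishes.  On the other hand N G = (1 - N) / c, so that N Pi = N G Y is
    (1 - N) Y / c by [rowproj_gram], and N is a contraction.  Hence N differs
    from 1 - Pi by a term of order 1 / c. *)
Lemma cvg_gram_resolvent i j :
  (fun k : nat => invmx (1%:M + k.+1%:R *: (M^T *m M)) i j) @ \oo -->
  (1%:M - Pi) i j.
Proof.
have [Y PY] := rowproj_gram; set G := M^T *m M in PY *.
pose N k := invmx (1%:M + k.+1%:R *: G).
have Nu k : 1%:M + k.+1%:R *: G \in unitmx by exact: gram_resolvent_unit.
have GP : G *m (1%:M - Pi) = 0.
  by rewrite mulmxBr mulmx1 /G -mulmxA mulmx_rowproj subrr.
have NQ k : N k *m (1%:M - Pi) = 1%:M - Pi.
  rewrite -[in RHS](mulKmx (Nu k) (1%:M - Pi)) -/(N k); congr (_ *m _).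
  by rewrite mulmxDl mul1mx -scalemxAl GP scaler0 addr0.
have NG k : N k *m G = k.+1%:R^-1 *: (1%:M - N k).
  have := mulVmx (Nu k); rewrite -/(N k) mulmxDr mulmx1 -scalemxAr => <-.
  by rewrite addrC addKr scalerA mulVf ?pnatr_eq0// scale1r.
have NE k : N k = (1%:M - Pi) + k.+1%:R^-1 *: ((1%:M - N k) *m Y).
  rewrite scalemxAl -NG -mulmxA -PY -[X in X + _](NQ k) -mulmxDr.
  by rewrite subrK mulmx1.
pose y := col j Y; pose b k := (1%:M - N k) *m y.
have NEij k : N k i j = (1%:M - Pi) i j + k.+1%:R^-1 * b k i 0.
  have bE : b k i 0 = ((1%:M - N k) *m Y) i j.
    by rewrite /b /y colE mulmxA -colE mxE.
  by rewrite bE {1}NE mxE; congr (_ + _); rewrite mxE.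
have b_bound k : `|b k i 0| <= norm2 y *+ 2.
  rewrite /b mulmxBl mul1mx mxE [X in _ + X]mxE.
  apply: le_trans (ler_normB _ _) _; rewrite mulr2n lerD ?norm2_coord//.
  by apply: le_trans (norm2_coord _ _) _; exact: gram_resolvent_contract.
rewrite (_ : (fun k : nat => _) =
    (fun k => (1%:M - Pi) i j + k.+1%:R^-1 * b k i 0)); last first.
  by apply/funext => k; exact: NEij.
rewrite -[X in _ --> X]addr0; apply: cvgD; first exact: cvg_cst.
apply: norm_cvg0; apply: (@squeeze_cvgr _ _ _ _ (fun=> 0)
  (fun k => norm2 y *+ 2 * harmonic k)).
- apply: nearW => k; rewrite normr_ge0/= normrM mulrC.
  by rewrite (@ger0_norm _ k.+1%:R^-1) ?invr_ge0// ler_wpM2r ?invr_ge0.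
- exact: cvg_cst.
- rewrite -[X in _ --> X](mulr0 (norm2 y *+ 2)).
  by apply: cvgMr => //; exact: cvg_harmonic.
Qed.

End RowProjection.
End MoorePenrose.

(** * Moments of a Gaussian sketch *)

Section SketchMoments.
Context (d : measure_display) (T : measurableType d) (R : realType).
Variable P : probability T R.
Variables m s : nat.
Variable X : 'I_m * 'I_s -> {RV P >-> R}.
Hypothesis XN : forall i (B : set R), measurable B ->
  distribution P (X i) B = normal_prob 0 1 B.
Hypothesis Xindep : mutually_independent X.

Let G (w : T) : 'M[R]_(m, s) := \matrix_(i, j) X (i, j) w.

Lemma sum_delta (I : finType) (i : I) (f : I -> R) :
  \sum_k (i == k)%:R * f k = f i.
Proof.
rewrite (bigD1 i)//= eqxx mul1r big1 ?addr0// => k ki.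
by rewrite eq_sym (negbTE ki) mul0r.
Qed.

(** Columns of S are standard Gaussian vectors g, and E <g, a>^2 = |a|^2. *)
Lemma has_mean_sketch_sqr (a : 'cV[R]_m) :
  has_mean P (fun w => norm2 ((G w)^T *m a) ^+ 2) (s%:R * norm2 a ^+ 2).
Proof.
apply: (@has_mean_ext _ _ _ P (fun w => \sum_(j < s) \sum_(i < m) \sum_(k < m)
  a i 0 * a k 0 * (X (i, j) w * X (k, j) w)) _
  (\sum_(j < s) \sum_(i < m) \sum_(k < m)
    a i 0 * a k 0 * ((i, j) == (k, j))%:R)).
- move=> w; rewrite norm2_sqr; apply: eq_bigr => j _.
  rewrite mxE expr2 big_distrlr /=; apply: eq_bigr => i _.
  by apply: eq_bigr => k _; rewrite !mxE; ring.
- rewrite norm2_sqr -[s in RHS]card_ord -sum1_card natr_sum mulr_suml.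
  apply: eq_bigr => j _; rewrite mul1r; apply: eq_bigr => i _.
  under eq_bigr => k _ do rewrite mulrC xpair_eqE eqxx andbT.
  by rewrite sum_delta expr2.
- apply: has_mean_sum => j; apply: has_mean_sum => i; apply: has_mean_sum => k.
  exact/has_meanZ/has_mean2.
Qed.

(** Each coordinate of A^T S S^T a is a sum over x = (j, i, k), j a column of
    S, i and k rows, of a coefficient times S i j * S k j.  In its square,
    Wick's formula pairs x with y in three ways: i = k inside x and inside y,
    which gives s^2 |A^T a|^2; x = y, which gives s |A|_F^2 |a|^2; and x equal
    to y with its rows exchanged, which gives s |A^T a|^2. *)
Lemma has_mean_sketch_fourth n (A : 'M[R]_(m, n)) (a : 'cV[R]_m) :
  has_mean P (fun w => norm2 (A^T *m (G w *m ((G w)^T *m a))) ^+ 2)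
    (s%:R * (s.+1%:R * norm2 (A^T *m a) ^+ 2 + frobnorm A ^+ 2 * norm2 a ^+ 2)).
Proof.
pose K : finType := ('I_s * ('I_m * 'I_m))%type.
pose c p (x : K) := A x.2.1 p * a x.2.2 0.
pose u (x : K) w := X (x.2.1, x.1) w * X (x.2.2, x.1) w.
pose swap (x : K) : K := (x.1, (x.2.2, x.2.1)).
pose wick (x y : K) : R :=
  (x.2.1 == x.2.2)%:R * (y.2.1 == y.2.2)%:R + (x == y)%:R + (swap x == y)%:R.
have sumK (f : K -> R) : \sum_x f x = \sum_j \sum_i \sum_k f (j, (i, k)).
  under [RHS]eq_bigr => j _ do rewrite pair_bigA.
  by rewrite pair_bigA; apply: eq_bigr => -[j [i k]].
have coordE w p : (A^T *m (G w *m ((G w)^T *m a))) p 0 = \sum_x c p x * u x w.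
  rewrite mxE sumK exchange_big /=; apply: eq_bigr => i _.
  rewrite !mxE mulr_sumr; apply: eq_bigr => j _.
  rewrite !mxE !mulr_sumr; apply: eq_bigr => k _.
  by rewrite !mxE /c /u /=; ring.
have sum_s (x : R) : \sum_(j < s) x = s%:R * x.
  by rewrite sumr_const card_ord mulr_natl.
have trA p : (A^T *m a) p 0 = \sum_i A i p * a i 0.
  by rewrite mxE; apply: eq_bigr => i _; rewrite mxE.
apply: (@has_mean_ext _ _ _ P
  (fun w => \sum_p \sum_x \sum_y c p x * c p y * (u x w * u y w)) _
  (\sum_p \sum_x \sum_y c p x * c p y * wick x y)).
- move=> w; rewrite norm2_sqr; apply: eq_bigr => p _.
  rewrite coordE expr2 big_distrlr /=; apply: eq_bigr => x _.
  by apply: eq_bigr => y _; ring.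
- rewrite !norm2_sqr frobnorm_sqr mulr_suml mulr_sumr -big_split mulr_sumr /=.
  apply: eq_bigr => p _; rewrite trA; set al := \sum_i A i p * a i 0.
  have paired : \sum_x c p x * (x.2.1 == x.2.2)%:R = s%:R * al.
    rewrite sumK -sum_s; apply: eq_bigr => j _; apply: eq_bigr => i _ /=.
    by under eq_bigr => k _ do rewrite mulrC /c /=; rewrite sum_delta.
  have same : \sum_x c p x ^+ 2 =
      s%:R * ((\sum_i A i p ^+ 2) * \sum_k a k 0 ^+ 2).
    rewrite sumK -sum_s; apply: eq_bigr => j _; rewrite big_distrlr /=.
    by apply: eq_bigr => i _; apply: eq_bigr => k _; rewrite /c /= exprMn.
  have swapped : \sum_x c p x * c p (swap x) = s%:R * al ^+ 2.
    rewrite sumK -sum_s; apply: eq_bigr => j _; rewrite expr2 big_distrlr /=.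
    by apply: eq_bigr => i _; apply: eq_bigr => k _; rewrite /c /=; ring.
  transitivity (\sum_x (c p x * (x.2.1 == x.2.2)%:R * (s%:R * al) + c p x ^+ 2 +
      c p x * c p (swap x))).
    apply: eq_bigr => x _; rewrite /wick.
    have := sum_delta x (fun y => c p x * c p y).
    have := sum_delta (swap x) (fun y => c p x * c p y).
    rewrite -expr2 => <- <-; rewrite -paired mulr_sumr -!big_split /=.
    by apply: eq_bigr => y _; ring.
  rewrite !big_split /= -mulr_suml paired same swapped; ring.
- apply: has_mean_sum => p; apply: has_mean_sum => x; apply: has_mean_sum => y.
  apply: has_meanZ; apply: (has_mean_ext _ _ (has_mean4 XN Xindep _ _ _ _)).
    by move=> w; rewrite /u mulrA.
  case: x => j [i k]; case: y => j' [i' k']; rewrite /wick /swap !xpair_eqE /=.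
  rewrite !eqxx !andbT -natrM mulnb.
  by congr (_%:R + _%:R + _%:R); case: eqP; case: eqP; case: eqP.
Qed.
End SketchMoments.

(** * Measurability of the iterates *)

Section MeasurableMatrices.
Context (d : measure_display) (T : measurableType d) (R : realType).

Definition measurable_mx m n (F : T -> 'M[R]_(m, n)) : Prop :=
  forall i j, measurable_fun setT (fun w => F w i j).

Lemma measurable_mx_cst m n (A : 'M[R]_(m, n)) : measurable_mx (fun=> A).
Proof. by move=> i j. Qed.

Lemma measurable_mxD m n (F H : T -> 'M[R]_(m, n)) :
  measurable_mx F -> measurable_mx H -> measurable_mx (fun w => F w + H w).
Proof.
move=> mF mH i j.
rewrite (_ : (fun w => _) = (fun w => F w i j + H w i j)); last first.
  by apply/funext => w; rewrite mxE.
exact: measurable_funD.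
Qed.

Lemma measurable_mxZ m n c (F : T -> 'M[R]_(m, n)) :
  measurable_mx F -> measurable_mx (fun w => c *: F w).
Proof.
move=> mF i j.
rewrite (_ : (fun w => _) = (fun w => c * F w i j)); last first.
  by apply/funext => w; rewrite mxE.
exact: measurable_funM.
Qed.

Lemma measurable_mxB m n (F H : T -> 'M[R]_(m, n)) :
  measurable_mx F -> measurable_mx H -> measurable_mx (fun w => F w - H w).
Proof.
move=> mF mH; under [X in measurable_mx X]funext do rewrite -scaleN1r.
exact/measurable_mxD/measurable_mxZ.
Qed.

Lemma measurable_mx_tr m n (F : T -> 'M[R]_(m, n)) :
  measurable_mx F -> measurable_mx (fun w => (F w)^T).
Proof.
move=> mF i j; rewrite (_ : (fun w => _) = (fun w => F w j i)); first exact: mF.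
by apply/funext => w; rewrite mxE.
Qed.

Lemma measurable_mxM m n p (F : T -> 'M[R]_(m, n)) (H : T -> 'M[R]_(n, p)) :
  measurable_mx F -> measurable_mx H -> measurable_mx (fun w => F w *m H w).
Proof.
move=> mF mH i j.
rewrite (_ : (fun w => _) = (fun w => \sum_k F w i k * H w k j)); last first.
  by apply/funext => w; rewrite mxE.
by apply: measurable_sum => k; exact: measurable_funM.
Qed.

Lemma measurable_det n (F : T -> 'M[R]_n) : measurable_mx F ->
  measurable_fun setT (fun w => \det (F w)).
Proof.
move=> mF; rewrite /determinant; apply: measurable_sum => g.
by apply: measurable_funM => //; apply: measurable_prod => i _; exact: mF.
Qed.

Lemma measurable_inv : measurable_fun setT (fun x : R => x^-1).
Proof.
(* This formula for the inverse also holds at 0, where both sides vanish. *)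
have mE : measurable_fun setT (fun x : R => x * expR (- ln (x ^+ 2))).
  apply: measurable_funM => //; apply: measurableT_comp => //.
  apply: measurableT_comp => //; apply: measurableT_comp => //.
apply: eq_measurable_fun mE => x _.
have [->|x0] := eqVneq x 0; first by rewrite invr0 mul0r.
by rewrite expRN lnK ?posrE ?exprn_even_gt0// expr2 invfM mulrA divff// mul1r.
Qed.

Lemma measurable_invmx n (F : T -> 'M[R]_n) : measurable_mx F ->
  (forall w, F w \in unitmx) -> measurable_mx (fun w => invmx (F w)).
Proof.
move=> mF Fu i j.
rewrite (_ : (fun w => _) = (fun w => (\det (F w))^-1 *
    ((-1) ^+ (j + i) * \det (row' j (col' i (F w)))))); last first.
  by apply/funext => w; rewrite /invmx Fu !mxE.
apply: measurable_funM.
  exact: (measurableT_comp measurable_inv (measurable_det mF)).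
apply: measurable_funM => //; apply: measurable_det => k l.
rewrite (_ : (fun w => _) = (fun w => F w (lift j k) (lift i l))) //.
by apply/funext => w; rewrite !mxE.
Qed.

(** The pseudo-inverse is discontinuous where the rank drops, hence the
    passage through the resolvents. *)
Lemma measurable_rowproj m n (M : T -> 'M[R]_(m, n)) : measurable_mx M ->
  measurable_mx (fun w => 1%:M - moore_penrose (M w) *m M w).
Proof.
move=> mM i j; apply: (measurable_fun_cvg
  (h := fun (k : nat) w => invmx (1%:M + k.+1%:R *: ((M w)^T *m M w)) i j)).
  move=> k; apply: measurable_invmx => [|w]; last exact: gram_resolvent_unit.
  apply: measurable_mxD; first exact: measurable_mx_cst.
  by apply/measurable_mxZ/measurable_mxM => //; exact: measurable_mx_tr.
by move=> w _; exact: cvg_gram_resolvent.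
Qed.

Lemma measurable_norm2_sqr n (F : T -> 'cV[R]_n) : measurable_mx F ->
  measurable_fun setT (fun w => norm2 (F w) ^+ 2).
Proof.
move=> mF.
rewrite (_ : (fun w => _) = (fun w => \sum_i F w i 0 ^+ 2)); last first.
  by apply/funext => w; rewrite norm2_sqr.
by apply: measurable_sum => i; apply: measurable_funX; exact: mF.
Qed.

End MeasurableMatrices.

Section KaczmarzError.
Variables (R : realType) (m n s : nat) (A : 'M[R]_(m, n)) (xstar : 'cV[R]_n).

(** Consistency of the system, in the form b = A xstar, turns the affine
    iteration into a linear one. *)
Lemma bgk_step_error (G : 'M[R]_(m, s)) x :
  bgk_step A (A *m xstar) G x - xstar =
  (1%:M - moore_penrose (G^T *m A) *m (G^T *m A)) *m (x - xstar).
Proof.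
rewrite /bgk_step [RHS]mulmxBr [X in _ = _ - X]mulmxBl mul1mx opprB addrA.
by rewrite !mulmxA.
Qed.

(** Only the draws before [k] enter, which makes the error measurable for the
    sigma-algebra of the past. *)
Lemma measurable_bgk_error (d : measure_display) (T : measurableType d)
    (G : nat -> T -> 'M[R]_(m, s)) x0 k :
  (forall j, (j < k)%N -> measurable_mx (G j)) ->
  measurable_mx (fun w => bgk A (A *m xstar) x0 (fun j => G j w) k - xstar).
Proof.
elim: k => [_|k IH mG] /=; first exact: measurable_mx_cst.
under [X in measurable_mx X]funext do rewrite bgk_step_error.
apply: measurable_mxM; last by apply: IH => j jk; apply: mG; exact: ltnW.
apply/measurable_rowproj/measurable_mxM; last exact: measurable_mx_cst.
by apply/measurable_mx_tr/mG.
Qed.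

End KaczmarzError.

(** * Contraction of the mean squared error *)

Section OneStep.
Context (d : measure_display) (T : measurableType d) (R : realType).
Variable P : probability T R.
Variables m n s : nat.
Variable X : 'I_m * 'I_s -> {RV P >-> R}.
Hypothesis XN : forall i (B : set R), measurable B ->
  distribution P (X i) B = normal_prob 0 1 B.
Hypothesis Xindep : mutually_independent X.
Variable A : 'M[R]_(m, n).

Let G (w : T) : 'M[R]_(m, s) := \matrix_(i, j) X (i, j) w.

Lemma sketched_gradient_step_mean (t : R) (e : 'cV[R]_n) (a := A *m e) :
  has_mean P (fun w => norm2 (e - t *: (A^T *m (G w *m ((G w)^T *m a)))) ^+ 2)
    (norm2 e ^+ 2 - (2 * t) * (s%:R * norm2 a ^+ 2) + t ^+ 2 *
      (s%:R * (s.+1%:R * norm2 (A^T *m a) ^+ 2 +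
               frobnorm A ^+ 2 * norm2 a ^+ 2))).
Proof.
apply: (@has_mean_ext _ _ _ P (fun w => norm2 e ^+ 2 +
  (- (2 * t)) * norm2 ((G w)^T *m a) ^+ 2 +
  t ^+ 2 * norm2 (A^T *m (G w *m ((G w)^T *m a))) ^+ 2) _ (_ + _ * _ + _)).
- move=> w; set y := A^T *m _.
  have ey : (e^T *m y) 0 0 = norm2 ((G w)^T *m a) ^+ 2.
    by rewrite norm2_sqr_dot /y /a !trmx_mul trmxK !mulmxA.
  rewrite [RHS]norm2_sqr_dot !(dotBl, dotBr, dotZl, dotZr) [(y^T *m e) 0 0]dotC.
  by rewrite ey -!norm2_sqr_dot; ring.
- by rewrite -mulNr.
- apply: has_meanD; last exact/has_meanZ/has_mean_sketch_fourth.
  apply: has_meanD; first exact: has_mean_cst.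
  exact/has_meanZ/has_mean_sketch_sqr.
Qed.

(** 1 / D, the minimizer over t of the bound
    |e|^2 - 2 t s |a|^2 + t^2 s D |a|^2 on the mean squared error. *)
Definition sketch_stepsize : R :=
  (s.+1%:R * opnorm A ^+ 2 + frobnorm A ^+ 2)^-1.

Definition contraction_factor : R :=
  1 - 80%:R^-1 * (Num.sqrt s%:R * sigma_min A /
    (Num.sqrt s%:R * opnorm A + frobnorm A)) ^+ 2.

(** D <= 2 (sqrt s |A| + |A|_F)^2, because |A| <= |A|_F. *)
Lemma contraction_le_stepsize (e : 'cV[R]_n) :
  80%:R^-1 * (Num.sqrt s%:R * sigma_min A /
    (Num.sqrt s%:R * opnorm A + frobnorm A)) ^+ 2 * norm2 e ^+ 2 <=
  sketch_stepsize * (s%:R * norm2 (A *m e) ^+ 2).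
Proof.
set q := Num.sqrt s%:R * opnorm A + frobnorm A; rewrite /sketch_stepsize.
set D := _ + _; set N := opnorm A in q D *; set F := frobnorm A in q D *.
have N0 : 0 <= N := opnorm_ge0 A; have F0 : 0 <= F := frobnorm_ge0 A.
have NF : N <= F := opnorm_le_frob A.
have s0 : 0 <= s%:R :> R by [].
have r0 := sqrtr_ge0 (s%:R : R); have r2 := sqr_sqrtr s0.
have q0 : 0 <= q by rewrite addr_ge0// mulr_ge0.
have D0 : 0 <= D by rewrite addr_ge0 ?mulr_ge0 ?sqr_ge0.
have Dq : D <= 2 * q ^+ 2.
  have NF2 : N ^+ 2 <= F ^+ 2 by rewrite ler_pXn2r.
  have rNF : 0 <= Num.sqrt s%:R * N * F by rewrite !mulr_ge0.
  have sN : 0 <= s%:R * N ^+ 2 by rewrite mulr_ge0 ?sqr_ge0.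
  rewrite /q sqrrD exprMn r2 /D -natr1 mulrDl mul1r; lra.
have inv_le : 80%:R^-1 * q^-1 ^+ 2 <= D^-1.
  have [->|qn0] := eqVneq q 0; first by rewrite invr0 expr0n mulr0 invr_ge0.
  have qgt0 : 0 < q ^+ 2 by rewrite exprn_gt0// lt_def qn0.
  have Dgt0 : 0 < D.
    rewrite lt_def D0 andbT; apply: contra_neq qn0 => D00.
    have : F ^+ 2 <= D by rewrite lerDr mulr_ge0 ?sqr_ge0.
    rewrite D00 => F2; have Fz : F = 0.
      by apply/eqP; rewrite -sqrf_eq0 eq_le F2 sqr_ge0.
    have Nz : N = 0 by apply/eqP; rewrite eq_le N0 andbT -Fz.
    by rewrite /q Fz Nz mulr0 addr0.
  rewrite exprVn -invfM lef_pV2 ?posrE ?mulr_gt0//; nra.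
have sA : sigma_min A ^+ 2 * norm2 e ^+ 2 <= norm2 (A *m e) ^+ 2.
  rewrite -exprMn ler_pXn2r ?nnegrE ?mulr_ge0 ?sigma_min_ge0 ?norm2_ge0//.
  exact: sigma_min_lb.
rewrite !exprMn r2.
have -> : 80%:R^-1 * (s%:R * sigma_min A ^+ 2 * q^-1 ^+ 2) * norm2 e ^+ 2 =
  (80%:R^-1 * q^-1 ^+ 2) * (s%:R * (sigma_min A ^+ 2 * norm2 e ^+ 2)) by ring.
apply: ler_pM => //.
- by apply: mulr_ge0; [rewrite invr_ge0|exact: sqr_ge0].
- by apply: mulr_ge0 => //; apply: mulr_ge0; exact: sqr_ge0.
- by apply: ler_wpM2l.
Qed.

(** For t = 1 / D the quadratic term t^2 s D |a|^2 is t s |a|^2, half of the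
    linear term. *)
Lemma sketched_gradient_step_le (e : 'cV[R]_n) :
  (\int[P]_w (norm2 (e - sketch_stepsize *:
      (A^T *m (G w *m ((G w)^T *m (A *m e))))) ^+ 2)%:E <=
   (contraction_factor * norm2 e ^+ 2)%:E)%E.
Proof.
have [_ ->] := sketched_gradient_step_mean sketch_stepsize e.
rewrite lee_fin; have := contraction_le_stepsize e; rewrite /contraction_factor.
set t := sketch_stepsize; set c := 80%:R^-1 * _; set a := A *m e.
have t0 : 0 <= t.
  rewrite /t /sketch_stepsize invr_ge0; apply: addr_ge0; last exact: sqr_ge0.
  by apply: mulr_ge0 => //; exact: sqr_ge0.
have trA : norm2 (A^T *m a) ^+ 2 <= opnorm A ^+ 2 * norm2 a ^+ 2.
  rewrite -exprMn ler_pXn2r ?nnegrE ?mulr_ge0 ?opnorm_ge0 ?norm2_ge0//.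
  exact: opnorm_tr.
(* For A = 0 the step size is 0^-1 = 0. *)
have ttD : t ^+ 2 * (s.+1%:R * opnorm A ^+ 2 + frobnorm A ^+ 2) = t.
  rewrite /t /sketch_stepsize; set D := _ + _.
  have [->|D0] := eqVneq D 0; first by rewrite invr0 mulr0.
  by rewrite expr2 mulfVK.
have le2 : t ^+ 2 * (s%:R * (s.+1%:R * norm2 (A^T *m a) ^+ 2 +
    frobnorm A ^+ 2 * norm2 a ^+ 2)) <= t * (s%:R * norm2 a ^+ 2).
  rewrite -[in leRHS]ttD -[leRHS]mulrA ler_wpM2l ?sqr_ge0//.
  rewrite [leRHS]mulrCA ler_wpM2l// [leRHS]mulrDl lerD2r -mulrA ler_wpM2l//.
lra.
Qed.

(** Read off from [sketched_gradient_step_le] at a unit vector: the factor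
    bounds the mean of a square. *)
Lemma contraction_factor_ge0 : (0 < n)%N -> 0 <= contraction_factor.
Proof.
move=> n0; have [e e1] := @unit_sphere_neq0 R n n0.
have := sketched_gradient_step_le e; rewrite e1 expr1n mulr1 -lee_fin.
by apply: le_trans; apply: integral_ge0 => w _; rewrite lee_fin sqr_ge0.
Qed.

End OneStep.

Theorem theorem2p3 (R : realType) (d : measure_display) (T : measurableType d)
    (P : probability T R) (m n s : nat)
    (A : 'M[R]_(m, n)) (b : 'cV[R]_m) (xstar x0 : 'cV[R]_n)
    (S : nat -> 'I_m * 'I_s -> {RV P >-> R})
    (hmn : (n <= m)%N) (hrank : \rank A = n) (hs : (1 <= s)%N)
    (hsol : A *m xstar = b) (hS : gaussian_draws S) (k : nat) :
  ('E_P[fun w => (norm2 (bgk A b x0 (fun j => draw S j w) k - xstar) ^+ 2)%R]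
   <= ((1 - 80%:R^-1 *
            (Num.sqrt s%:R * sigma_min A /
             (Num.sqrt s%:R * opnorm A + frobnorm A)) ^+ 2) ^+ k
       * norm2 (x0 - xstar) ^+ 2)%R%:E)%E.
Proof.
have [XN Xindep past] := hS.
rewrite -hsol -/(contraction_factor s A) unlock.
pose err k w := bgk A (A *m xstar) x0 (fun j => draw S j w) k - xstar.
elim: k => [|k IH].
  by rewrite expr0 mul1r /= (has_mean_cst P (norm2 (x0 - xstar) ^+ 2)).2.
(* For n = 0 all errors vanish; otherwise there are unit vectors, which show
   that the factor is nonnegative. *)
have [n0|n0] := posnP n.
  subst n; rewrite [X in (_ * X)%:E]expr2 !cV0_norm2 !mulr0.
  under eq_integral do rewrite cV0_norm2 expr0n.
  by rewrite (has_mean_cst P 0).2.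
have rho0 : 0 <= contraction_factor s A.
  exact: (contraction_factor_ge0 (XN 0%N) (Xindep 0%N)).
pose t := sketch_stepsize s A.
pose T1 := g_sigma_algebraType (generators (S k) setT).
pose past_gen := generators (fun p : nat * ('I_m * 'I_s) => S p.1 p.2)
  [set p | (p.1 < k)%N].
pose T2 := g_sigma_algebraType past_gen.
(* The Tonelli step is applied to [f], where the draw and the current error are
   evaluated at independent points [z.1] and [z.2]. *)
pose step (G : 'M[R]_(m, s)) (e : 'cV[R]_n) :=
  e - t *: (A^T *m (G *m (G^T *m (A *m e)))).
have mG : measurable_mx (draw S k : T1 -> _).
  move=> i j; rewrite (_ : (fun w => _) = S k (i, j)); last first.
    by apply/funext => w; rewrite mxE.
  exact: measurable_coord.
have merr : measurable_mx (err k : T2 -> _).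
  apply: measurable_bgk_error => l lk i j.
  rewrite (_ : (fun w => _) = S l (i, j)); last first.
    by apply/funext => w; rewrite mxE.
  exact: (@measurable_coord _ _ _ _ _ (fun p : nat * ('I_m * 'I_s) => S p.1 p.2)
    [set p | (p.1 < k)%N] (l, (i, j))).
pose f (z : T1 * T2) := (norm2 (step (draw S k z.1) (err k z.2)) ^+ 2)%:E.
have mf : measurable_fun setT f.
  apply/measurable_EFinP; apply: measurable_norm2_sqr.
  have mfst : measurable_mx (fun z : T1 * T2 => draw S k z.1).
    by move=> i j; exact: (measurableT_comp (mG i j) measurable_fst).
  have msnd : measurable_mx (fun z : T1 * T2 => err k z.2).
    by move=> i j; exact: (measurableT_comp (merr i j) measurable_snd).
  apply: measurable_mxB => //; apply: measurable_mxZ.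
  apply: measurable_mxM; first exact: measurable_mx_cst.
  apply: measurable_mxM => //; apply: measurable_mxM.
    exact: measurable_mx_tr.
  by apply: measurable_mxM => //; exact: measurable_mx_cst.
have f0 z : (0 <= f z)%E by rewrite lee_fin sqr_ge0.
have mdraw l : measurable_mx (draw S l).
  move=> i j; rewrite (_ : (fun w => _) = S l (i, j)); last first.
    by apply/funext => w; rewrite mxE.
  exact: measurable_funP.
have merrT l : measurable_mx (err l).
  by apply: measurable_bgk_error => ? _; exact: mdraw.
have mgen1 := measurable_generators (X := S k) (D := setT).
have mgen2 : past_gen `<=` measurable by exact: measurable_generators.
have mdiag : measurable_fun setT (fun w : T => f (w, w)).
  exact: (measurableT_comp mf (measurable_fun_pair
    (measurable_id_sub mgen1) (measurable_id_sub mgen2))).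
apply: (@le_trans _ _ (\int[P]_w f (w, w))%E).
  apply: ge0_le_integral => //.
  - by move=> w _; rewrite lee_fin sqr_ge0.
  - by apply/measurable_EFinP; exact: (measurable_norm2_sqr (merrT k.+1)).
  - move=> w _; rewrite /f lee_fin /= /err /= bgk_step_error -/(err k w).
    rewrite /step; set e := err k w; set G := draw S k w.
    rewrite (_ : A^T *m _ = (G^T *m A)^T *m (G^T *m (A *m e))); last first.
      by rewrite trmx_mul trmxK !mulmxA.
    by rewrite scalemxAr; exact: rowproj_best.
rewrite (indep_systems_tonelli mgen1 mgen2 (past k))//.
apply: (@le_trans _ _
  (\int[P]_v (contraction_factor s A * norm2 (err k v) ^+ 2)%:E)%E).
  apply: ge0_le_integral => //.
  - by move=> v _; exact: integral_ge0.
  - exact: (measurable_partial_integral_systems P mgen1 mgen2).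
  - apply/measurable_EFinP; apply: measurable_funM => //.
    exact: (measurable_norm2_sqr (merrT k)).
  - move=> v _; rewrite /f /= /step /t; move: (err k v) => e.
    exact: (sketched_gradient_step_le (XN k) (Xindep k) A e).
under eq_integral do rewrite EFinM.
rewrite ge0_integralZl//; last 2 first.
- by apply/measurable_EFinP; exact: (measurable_norm2_sqr (merrT k)).
- by move=> w _; rewrite lee_fin sqr_ge0.
by rewrite exprS -mulrA EFinM lee_wpmul2l// lee_fin.
Qed.
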